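(* There exists an absolute constant $C>0$ such that, for all $n\ge3$, $$\sup_{x\in\mathbb R}\left|\mathbb P(Y_n\le x)-\Phi(x)\right|\le C\,\frac{\log n}{\sqrt n}.$$ In particular, $Y_n=\frac{\log q_n-n}{\sqrt n}$ converges in distribution to the standard normal distribution $N(0,1)$ as $n\to\infty$.
   Context: Every $x\in(0,1)$ has a unique (infinite) Engel expansion $x=\frac1{q_1}+\frac1{q_1q_2}+\cdots+\frac1{q_1q_2\cdots q_n}+\cdots$ with integer digits $q_n=q_n(x)$ satisfying $q_{n+1}\ge q_n\ge2$. The expanded number is taken uniformly distributed on $(0,1)$, which makes the $q_n$ random variables. It is known that $(q_n)_{n\ge1}$ is then a time-homogeneous Markov chain on $\{2,3,\ldots\}$ with transition probabilities $\mathbb P(q_n=k\mid q_{n-1}=j)=\frac{j-1}{k(k-1)}$ for $k\ge j\ge2$, and initial distribution $\mathbb P(q_1=k)=\frac1{k(k-1)}$, $k\ge2$. Notation: $Y_n:=\frac{\log q_n-n}{\sqrt n}$; $\Phi$ is the standard normal distribution function. *)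

(* Defs.v *)
From HB Require Import structures.
From mathcomp Require Import all_boot all_order all_algebra.
From mathcomp Require Import all_classical all_reals all_analysis.
Import Order.TTheory GRing.Theory Num.Theory.
Import numFieldNormedType.Exports.

Set Implicit Arguments.
Unset Strict Implicit.
Unset Printing Implicit Defensive.

Local Open Scope classical_set_scope.
Local Open Scope ring_scope.

(* Digits are indexed from 0: [q n] is the digit usually written q_(n+1). *)
Definition engel_expansion (R : realType) (x : R) (q : nat -> nat) : Prop :=
  (forall n, (2 <= q n <= q n.+1)%N) /\
  series (fun n => (\prod_(i < n.+1) (q i)%:R)^-1) @ \oo --> x.

(* Expansions exist and are unique for 0 < x < 1; when x has no expansion at
   all, the default sequence (all digits 2) is returned. *)
Definition engel_digits (R : realType) (x : R) : nat -> nat :=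
  xget (fun=> 2%N) [set q | engel_expansion x q].

(* The digit q_n(x) with the usual indexing n >= 1. *)
Definition engel_digit (R : realType) (n : nat) (x : R) : nat :=
  engel_digits x n.-1.

(* Y_n; only meaningful for n >= 1. *)
Definition normalized_log_digit (R : realType) (n : nat) (x : R) : R :=
  (ln (engel_digit n x)%:R - n%:R) / Num.sqrt n%:R.

Definition std_normal_cdf (R : realType) (x : R) : \bar R :=
  normal_prob (0 : R) 1 `]-oo, x]%classic.

(* Equality of laws is required on measurable sets only, the value of a measure
   being irrelevant elsewhere. *)
Definition uniform01 d (T : measurableType d) (R : realType)
    (P : probability T R) (X : {RV P >-> R}) : Prop :=
  forall A : set R, measurable A ->
    distribution P X A = uniform_prob (@ltr01 R) A.

Definition cvg_in_distribution d (T : measurableType d) (R : realType)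
    (P : probability T R) (Y : nat -> T -> R)
    (mu : probability (measurableTypeR R) R) : Prop :=
  forall x : R, {for x, continuous (fun y : R => mu `]-oo, y]%classic)} ->
    P [set w | Y n w <= x] @[n --> \oo] --> mu `]-oo, x]%classic.

(* Main.v *)
Require Import Defs.
From HB Require Import structures.
From mathcomp Require Import all_boot all_order all_algebra.
From mathcomp Require Import all_classical all_reals all_analysis.
From mathcomp Require Import ring lra zify.
Import Order.TTheory GRing.Theory Num.Theory.
Import numFieldNormedType.Exports.

(** Write r_n = q_n - 1 and r_0 = 1. Given r_n = j, the event r_{n+1} >= i has
    probability j / i for every i >= j: up to rounding, r_{n+1} is r_n / U
    with U uniform. So ln r_n should be close to a sum of n independent
    standard exponential variables, whose tail is the Erlang tail
    e^-t (1 + t + ... + t^(n-1) / (n-1)!), and such a sum is close to a normal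
    variable with mean n and variance n. Both comparisons are made on the
    distribution functions themselves, without characteristic functions or
    couplings.

    Law of the digits. Let b n j be the length of the set of x in (0, 1/j]
    whose n-th digit exceeds m. The first digit of x in (1/(j+1), 1/j] is j+1
    and its other digits are those of (j+1) x - 1, which ranges over (0, 1/j];
    hence b n.+1 j = b n.+1 j.+1 + b n j / j.+1 for j < m ([tail_set_step],
    [tail_measureS]). By induction all sets involved are finite unions of
    intervals, so no measure theory beyond lengths is needed.

    From digits to Erlang tails. Let [expsum n] be the sum of the first n
    terms of the exponential series; the derivative of [expsum n.+1] is
    [expsum n]. Reading the recursion as a discretised integration gives
    expsum n (H_m - H_j) <= m b n j <= expsum n (ln (m / j)) for n >= 1, with
    H the harmonic numbers. The upper bound at j = 1 is the Erlang tail at ln m. The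
    lower bound is sharp only for large j, so it is applied from a level K of
    order sqrt n: starting at 1, the digits pass K within i = O(ln n) steps
    except with probability K (2/3)^i ([tail_rec_start_level]). Dropping i
    steps changes the Erlang tail by i Poisson weights of size O(1 / sqrt n);
    this is where the factor ln n comes from ([tail_rec_erlang]).

    From Erlang tails to the normal law. With s = sqrt n, the Erlang density
    at n + x s is its peak value times exp (n (ln (1 + x/s) - x/s)), and this
    exponential differs from exp (- x^2 / 2) by at most a constant times
    1 / (s (1 + x^2)) ([gauss_approx]). The primitive of that bound is the
    bounded function atan, so the distribution functions agree up to
    O(1 / s), after multiplication of the normal one by a constant; both have
    total mass 1, which forces the constant to be 1 + O(1 / s) and makes
    Stirling's formula unnecessary ([peak_ratio_near1],
    [erlang_cdf_normal]). *)

Set Implicit Arguments.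
Unset Strict Implicit.
Unset Printing Implicit Defensive.

Local Open Scope classical_set_scope.
Local Open Scope ring_scope.

(** * Comparing functions through their derivatives *)

Section Calculus.
Context {R : realType}.
Implicit Types (f g df dg : R -> R) (a b x y t : R).

Lemma derive_ge0_le f df a b : a <= b ->
  (forall x, a < x < b -> is_derive x 1 f (df x)) ->
  (forall x, a <= x <= b -> {for x, continuous f}) ->
  (forall x, a < x < b -> 0 <= df x) -> f a <= f b.
Proof.
move=> ab fdf fc df0; have [->//|neq] := eqVneq a b.
have ltab : a < b by rewrite lt_neqAle neq.
have fdf' x : x \in `]a, b[ -> is_derive x 1 f (df x).
  by rewrite in_itv/=; exact: fdf.
have fc' : {within `[a, b], continuous f}.
  apply: continuous_in_subspaceT => x; rewrite inE/= in_itv/=; exact: fc.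
have [c + fE] := MVT ltab fdf' fc'.
rewrite in_itv/= => cab; rewrite -subr_ge0 fE mulr_ge0 ?subr_ge0 ?df0//.
Qed.

Lemma derive_norm_le f df g dg a b : a <= b ->
  (forall x, a < x < b -> is_derive x 1 f (df x)) ->
  (forall x, a <= x <= b -> {for x, continuous f}) ->
  (forall x, a < x < b -> is_derive x 1 g (dg x)) ->
  (forall x, a <= x <= b -> {for x, continuous g}) ->
  (forall x, a < x < b -> `|df x| <= dg x) -> `|f b - f a| <= g b - g a.
Proof.
move=> ab fdf fc gdg gc h.
have h1 : g a - f a <= g b - f b.
  apply: (@derive_ge0_le (fun x => g x - f x) (fun x => dg x - df x)) => //.
  - by move=> x xab; have := fdf _ xab; have := gdg _ xab => ? ?; exact: is_deriveB.
  - by move=> x xab; apply: cvgB; [exact: gc|exact: fc].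
  - by move=> x xab; rewrite subr_ge0 (le_trans (ler_norm _))// h.
have h2 : g a + f a <= g b + f b.
  apply: (@derive_ge0_le (fun x => g x + f x) (fun x => dg x + df x)) => //.
  - by move=> x xab; have := fdf _ xab; have := gdg _ xab => ? ?; exact: is_deriveD.
  - by move=> x xab; apply: cvgD; [exact: gc|exact: fc].
  - move=> x xab; rewrite addrC -lerBlDr sub0r.
    by have := h _ xab; rewrite ler_norml => /andP[].
rewrite ler_norml; apply/andP; split; lra.
Qed.

(** [is_derive1_comp] with the composite in applied form, the shape in which
    derivatives of explicit functions are stated below. *)
Lemma is_derive1_compR (f g : R -> R) (x df dg : R) :
  is_derive (g x) 1 f df -> is_derive x 1 g dg ->
  is_derive x 1 (fun z => f (g z)) (df * dg).
Proof. exact: is_derive1_comp. Qed.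

Lemma is_derive_continuous (f : R -> R) (x df : R) :
  is_derive x 1 f df -> {for x, continuous f}.
Proof.
by move=> [fx _]; apply/differentiable_continuous; exact/derivable1_diffP.
Qed.

Lemma expR_lip (a b c : R) : a <= c -> b <= c ->
  `|expR a - expR b| <= `|a - b| * expR c.
Proof.
wlog ab : a b / a <= b.
  move=> h ac bc; have [/h|/ltW/h] := leP a b; first exact.
  by rewrite distrC [X in _ <= X * _]distrC; exact.
move=> ac bc; rewrite distrC ger0_norm ?subr_ge0 ?ler_expR//.
rewrite distrC ger0_norm ?subr_ge0//.
apply: (@le_trans _ _ ((b - a) * expR b)); last first.
  by rewrite ler_wpM2l ?subr_ge0// ler_expR.
have -> : expR a = expR b * expR (a - b) by rewrite -expRD addrC subrK.
rewrite -[X in X - _]mulr1 -mulrBr mulrC ler_wpM2r ?expR_ge0//.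
by have := expR_ge1Dx (a - b); lra.
Qed.

End Calculus.

(** * The exponent of the Erlang density against the Gaussian one *)

Section LogBounds.
Context {R : realType}.
Implicit Types (y : R).

(** The remainder of ln (1 + y) after its quadratic Taylor polynomial. Its
    derivative y^2 / (1 + y) is explicit and nonnegative, so each bound on it
    follows by comparing derivatives with those of a monomial. *)
Definition log_rem y : R := ln (1 + y) - y + y ^+ 2 / 2.

Lemma log_rem0 : log_rem 0 = 0.
Proof. by rewrite /log_rem addr0 ln1 subr0 expr0n /= mul0r addr0. Qed.

Lemma is_derive_log_rem y : -1 < y ->
  is_derive y 1 log_rem (y ^+ 2 / (1 + y)).
Proof.
move=> y1; have y0 : 0 < 1 + y by lra.
have d0 : is_derive y 1 (fun z : R => 1 + z) 1.
  have : is_derive y 1 (cst 1 + id : R -> R) (0 + 1) by exact: is_deriveD.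
  by rewrite add0r.
have d1 := is_derive1_compR (is_derive1_ln y0) d0.
rewrite /log_rem; apply: is_derive_eq.
rewrite /GRing.scale /=; field.
by rewrite gt_eqF.
Qed.

Lemma log_rem_le y : 0 <= y -> log_rem y <= y ^+ 3 / 3.
Proof.
move=> y0; pose f (x : R) := x ^+ 3 / 3 - log_rem x.
have df (x : R) : -1 < x -> is_derive x 1 f (x ^+ 2 - x ^+ 2 / (1 + x)).
  move=> x1; have d1 := is_derive_log_rem x1.
  rewrite /f; apply: is_derive_eq; rewrite /GRing.scale /=; field.
  by apply: lt0r_neq0; lra.
have : f 0 <= f y.
  clearbody f; apply: (derive_ge0_le y0) => x /andP[x0 _].
  - by apply: df; lra.
  - by apply: (is_derive_continuous (df x _)); lra.
  - rewrite subr_ge0 ler_pdivrMr; last lra.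
    by rewrite ler_peMr ?sqr_ge0//; lra.
by rewrite /f log_rem0 expr0n /= mul0r !subr0 subr_ge0.
Qed.

Lemma log_rem_homo x y : -1 < x -> x <= y -> log_rem x <= log_rem y.
Proof.
move=> x1 xy; apply: (@derive_ge0_le _ log_rem _ _ _ xy) => z /andP[z1 _].
- by apply: is_derive_log_rem; lra.
- by apply/is_derive_continuous/is_derive_log_rem; lra.
- by rewrite divr_ge0 ?sqr_ge0//; lra.
Qed.

Lemma log_rem_ge y : - 1 / 2 <= y -> y <= 0 -> 2 / 3 * y ^+ 3 <= log_rem y.
Proof.
move=> y1 y0; pose f (x : R) := 2 / 3 * x ^+ 3 - log_rem x.
have df (x : R) : -1 < x -> is_derive x 1 f (2 * x ^+ 2 - x ^+ 2 / (1 + x)).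
  move=> x1; have d1 := is_derive_log_rem x1.
  rewrite /f; apply: is_derive_eq; rewrite /GRing.scale /=; field.
  by apply: lt0r_neq0; lra.
have : f y <= f 0.
  clearbody f; apply: (derive_ge0_le y0) => x /andP[x0 _].
  - by apply: df; lra.
  - by apply: (is_derive_continuous (df x _)); lra.
  - rewrite subr_ge0 ler_pdivrMr; last lra.
    by rewrite mulrAC -[leLHS]mul1r ler_wpM2r ?sqr_ge0//; lra.
by rewrite /f log_rem0 expr0n /= mulr0 !subr0 subr_le0.
Qed.

Lemma log_rem_abs y : - 1 / 2 <= y -> `|log_rem y| <= `|y| ^+ 3.
Proof.
move=> y1; have [y0|y0] := leP 0 y.
  have := log_rem_le y0; have := log_rem_homo (ltrN10 R) y0.
  rewrite log_rem0 => h1 h2; rewrite !ger0_norm//.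
  by apply: (le_trans h2); rewrite ler_pdivrMr// ler_peMr ?exprn_ge0// ler1n.
have := log_rem_ge y1 (ltW y0); have := @log_rem_homo y 0 _ (ltW y0).
rewrite log_rem0 => h1 h2; rewrite ler0_norm ?h1//; last lra.
rewrite ltr0_norm// exprNn -signr_odd /= expr1 mulN1r lerN2.
apply: le_trans h2; have : y ^+ 3 <= 0 by rewrite exprn_odd_le0// ltW.
lra.
Qed.

(** The constant 1/3 < 1/2 keeps - y^2 / 2 + log_rem y below - y^2 / 6 up to
    y = 1, that is, the Erlang density has Gaussian decay up to twice its
    mode. *)
Lemma log_rem_upper y : - 1 < y <= 1 -> log_rem y <= y ^+ 2 / 3.
Proof.
move=> /andP[y1 y2]; have [y0|y0] := leP 0 y.
  apply: (le_trans (log_rem_le y0)).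
  by rewrite ler_pM2r// exprS ler_piMl ?sqr_ge0.
apply: (@le_trans _ _ 0); last by rewrite divr_ge0 ?sqr_ge0.
by rewrite -log_rem0 log_rem_homo// ltW.
Qed.

(** Since e^(x^2 / 18) >= (1 + x^2) / 18, a cube gives the bound; the cube
    leaves room for a factor |x|^3 and still an integrable 1 / (1 + x^2). *)
Lemma gauss_decay (x : R) : expR (- (x ^+ 2 / 6)) <= 18 ^+ 3 / (1 + x ^+ 2) ^+ 3.
Proof.
have x2 := sqr_ge0 x.
have h : ((1 + x ^+ 2) / 18) ^+ 3 <= expR (x ^+ 2 / 6).
  have -> : x ^+ 2 / 6 = (x ^+ 2 / 18) * 3%:R by field.
  rewrite expRM_natr lerXn2r ?nnegrE ?expR_ge0//; first by lra.
  by have := expR_ge1Dx (x ^+ 2 / 18); lra.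
rewrite expRN -expr_div_n -[18 / _]invf_div exprVn.
rewrite lef_pV2// posrE ?expR_gt0// exprn_gt0//.
by rewrite divr_gt0//; lra.
Qed.

(** For x / s >= - 1/2 the exponents differ by s^2 log_rem (x / s), of size
    |x|^3 / s, and both are at most - x^2 / 6. For x / s < - 1/2 the
    two exponentials are separately negligible, because x^2 is of the order of
    s^2. *)
Lemma gauss_approx (s x : R) : 1 <= s -> - s < x <= s ->
  `| expR (s ^+ 2 * (ln (1 + x / s) - x / s)) - expR (- (x ^+ 2 / 2)) |
    <= 2 * 18 ^+ 3 / s * (1 + x ^+ 2)^-1.
Proof.
move=> s1 /andP[xs1 xs2]; have s0 : 0 < s by lra.
set y := x / s.
have y1 : -1 < y by rewrite /y ltr_pdivlMr// mulN1r.
have y2 : y <= 1 by rewrite /y ler_pdivrMr// mul1r.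
have xE : x = s * y by rewrite /y mulrCA divff ?mulr1// gt_eqF.
have wE : s ^+ 2 * (ln (1 + y) - y) = - (x ^+ 2 / 2) + s ^+ 2 * log_rem y.
  by rewrite xE /log_rem; field.
have s20 : 0 <= s ^+ 2 := sqr_ge0 s.
have x20 : 0 <= x ^+ 2 := sqr_ge0 x.
have wle : s ^+ 2 * (ln (1 + y) - y) <= - (x ^+ 2 / 6).
  rewrite wE; have := @log_rem_upper y; rewrite y1 y2 => /(_ isT) h.
  have : s ^+ 2 * log_rem y <= s ^+ 2 * (y ^+ 2 / 3) by rewrite ler_wpM2l.
  by rewrite mulrA -exprMn -xE; lra.
have wle2 : - (x ^+ 2 / 2) <= - (x ^+ 2 / 6) by lra.
have [yh|yh] := leP (- 1 / 2) y.
  apply: le_trans (expR_lip wle wle2) _.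
  have -> : s ^+ 2 * (ln (1 + y) - y) - - (x ^+ 2 / 2) = s ^+ 2 * log_rem y.
    by rewrite wE; ring.
  rewrite normrM (ger0_norm s20).
  apply: (@le_trans _ _ (`|x| ^+ 3 / s * (18 ^+ 3 / (1 + x ^+ 2) ^+ 3))).
    apply: ler_pM; rewrite ?mulr_ge0 ?expR_ge0 ?gauss_decay ?invr_ge0 ?(ltW s0)//.
    have -> : `|x| ^+ 3 / s = s ^+ 2 * `|y| ^+ 3.
      rewrite xE normrM exprMn (gtr0_norm s0); field.
      by rewrite gt_eqF.
    by rewrite ler_wpM2l// log_rem_abs.
  have h : `|x| ^+ 3 <= (1 + x ^+ 2) ^+ 2.
    rewrite -(real_normK (num_real x)); have : 0 <= `|x| by [].
    by move: `|x| => z z0; nra.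
  have -> : 2 * 18 ^+ 3 / s * (1 + x ^+ 2)^-1 =
    ((1 + x ^+ 2) ^+ 2 * 2) / s * (18 ^+ 3 / (1 + x ^+ 2) ^+ 3).
    by field; apply/andP; split; apply: lt0r_neq0; lra.
  rewrite ler_wpM2r//; first by rewrite divr_ge0// exprn_ge0//; lra.
  rewrite ler_wpM2r ?invr_ge0 ?(ltW s0)//; apply: (le_trans h).
  by rewrite ler_peMr ?sqr_ge0// ler1n.
apply: (@le_trans _ _ (expR (- (x ^+ 2 / 6)))).
  have e1 := wle; have e2 := wle2; rewrite -ler_expR in e1; rewrite -ler_expR in e2.
  have := expR_ge0 (s ^+ 2 * (ln (1 + y) - y)).
  have := expR_ge0 (- (x ^+ 2 / 2)).
  by move=> ? ?; rewrite ler_norml; apply/andP; split; lra.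
apply: (le_trans (gauss_decay x)).
have hs : s <= 2 * (1 + x ^+ 2).
  have : y ^+ 2 >= 1 / 4 by nra.
  have -> : x ^+ 2 = s ^+ 2 * y ^+ 2 by rewrite xE exprMn.
  nra.
have -> : 2 * 18 ^+ 3 / s * (1 + x ^+ 2)^-1 = 18 ^+ 3 * (2 / s) * (1 + x ^+ 2)^-1.
  by field; apply/andP; split; apply: lt0r_neq0; lra.
have -> : 18 ^+ 3 / (1 + x ^+ 2) ^+ 3 =
    18 ^+ 3 * ((1 + x ^+ 2) ^+ 2)^-1 * (1 + x ^+ 2)^-1.
  by field; apply: lt0r_neq0; lra.
rewrite ler_wpM2r ?invr_ge0//; first lra.
rewrite ler_wpM2l// -lef_pV2 ?posrE ?divr_gt0 ?invr_gt0 ?exprn_gt0//; last lra.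
rewrite invrK invf_div; nra.
Qed.
End LogBounds.

(** * Erlang tails and Poisson weights *)

Section Erlang.
Context {R : realType}.
Implicit Types (t u : R) (n k : nat).

Definition expsum n t : R := \sum_(k < n) t ^+ k / k`!%:R.
(** [pois n t] and [erlang_tail n t] are the probabilities that a Poisson
    variable with mean t equals n and is smaller than n; the latter is also
    the probability that a sum of n independent standard exponential
    variables exceeds t. *)
Definition pois n t : R := expR (- t) * (t ^+ n / n`!%:R).
Definition erlang_tail n t : R := expR (- t) * expsum n t.

Lemma factr_gt0 n : 0 < n`!%:R :> R.
Proof. by rewrite ltr0n fact_gt0. Qed.

Lemma expsumS n t : expsum n.+1 t = expsum n t + t ^+ n / n`!%:R.
Proof. by rewrite /expsum big_ord_recr. Qed.

Lemma expsum0 n : expsum n.+1 0 = 1.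
Proof.
elim: n => [|n IH]; first by rewrite /expsum big_ord1 expr0 fact0 divr1.
by rewrite expsumS IH expr0n mul0r addr0.
Qed.

Lemma expsum_ge0 n t : 0 <= t -> 0 <= expsum n t.
Proof. by move=> t0; apply: sumr_ge0 => k _; rewrite divr_ge0 ?exprn_ge0. Qed.

Lemma pois_ge0 n t : 0 <= t -> 0 <= pois n t.
Proof. by move=> t0; rewrite mulr_ge0 ?expR_ge0 ?divr_ge0 ?exprn_ge0. Qed.

Lemma erlangS n t : erlang_tail n.+1 t = erlang_tail n t + pois n t.
Proof. by rewrite /erlang_tail expsumS mulrDr. Qed.

Lemma erlang_ge0 n t : 0 <= t -> 0 <= erlang_tail n t.
Proof. by move=> t0; rewrite mulr_ge0 ?expR_ge0 ?expsum_ge0. Qed.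

Lemma erlang0 n : erlang_tail n.+1 0 = 1.
Proof. by rewrite /erlang_tail expsum0 oppr0 expR0 mulr1. Qed.

Lemma is_derive_expsum n t : is_derive t 1 (expsum n.+1) (expsum n t).
Proof.
elim: n => [|n IH].
  have -> : expsum 1 = cst 1.
    by apply/funext => z; rewrite /expsum big_ord1 expr0 fact0 divr1.
  by rewrite /expsum big_ord0; exact: is_derive_cst.
have -> : expsum n.+2 = (fun z => expsum n.+1 z + z ^+ n.+1 / n.+1`!%:R).
  by apply/funext => z; rewrite expsumS.
rewrite [X in is_derive _ _ _ X]expsumS; apply: is_deriveD.
have -> : (fun z : R => z ^+ n.+1 / n.+1`!%:R) = n.+1`!%:R^-1 \*: (id ^+ n.+1).
  by apply/funext => z; rewrite /= exprfctE /GRing.scale /= mulrC.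
apply: is_derive_eq; rewrite /GRing.scale /= mulr1.
have := factr_gt0 n; rewrite factS natrM; move: (n`!%:R : R) => c c0.
by field; rewrite !gt_eqF//= addrC natr1 ltr0n.
Qed.

Lemma is_derive_erlang n t : is_derive t 1 (erlang_tail n.+1) (- pois n t).
Proof.
have d1 : is_derive t 1 (fun z : R => expR (- z)) (expR (- t) * -1).
  by apply: is_derive1_compR.
have d2 := is_derive_expsum n t.
rewrite /erlang_tail; apply: is_derive_eq.
rewrite /GRing.scale /= expsumS /pois; ring.
Qed.

Lemma erlang_homo n t u : 0 <= t -> t <= u ->
  erlang_tail n.+1 u <= erlang_tail n.+1 t.
Proof.
move=> t0 tu; rewrite -lerN2.
have d (x : R) : is_derive x 1 (fun z : R => - erlang_tail n.+1 z) (pois n x).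
  have := is_derive_erlang n x => dd; apply: is_derive_eq.
  by rewrite opprK.
apply: (@derive_ge0_le _ (fun z => - erlang_tail n.+1 z) _ _ _ tu) => x /andP[x0 _].
- exact: (is_derive_continuous (d x)).
- by rewrite pois_ge0//; lra.
Qed.

Lemma erlang_le1 n t : 0 <= t -> erlang_tail n t <= 1.
Proof.
move=> t0; apply: (@le_trans _ _ (erlang_tail n.+1 t)).
  by rewrite erlangS lerDl pois_ge0.
by rewrite -(erlang0 n) erlang_homo.
Qed.

Lemma expsum_le_expR n t : 0 <= t -> expsum n t <= expR t.
Proof.
move=> t0; have := erlang_le1 n t0.
by rewrite /erlang_tail expRN mulrC ler_pdivrMr ?expR_gt0// mul1r.
Qed.

Lemma pois_le1 n t : 0 <= t -> pois n t <= 1.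
Proof.
move=> t0; apply: le_trans (erlang_le1 n.+1 t0).
by rewrite erlangS lerDr erlang_ge0.
Qed.

(** From 1 + z <= e^z at z = t / n - 1, raised to the power n. *)
Lemma pois_peak n t : (0 < n)%N -> 0 <= t -> pois n t <= pois n n%:R.
Proof.
move=> n0 t0; have nR : 0 < n%:R :> R by rewrite ltr0n.
rewrite /pois 2!mulrA ler_pM2r ?invr_gt0 ?factr_gt0//.
have h : t ^+ n <= n%:R ^+ n * expR (t - n%:R).
  have -> : t - n%:R = (t / n%:R - 1) * n%:R.
    by rewrite mulrBl divfK ?gt_eqF// mul1r.
  rewrite expRM_natr -exprMn lerXn2r ?nnegrE ?mulr_ge0 ?expR_ge0 ?(ltW nR)//.
  rewrite mulrC -ler_pdivrMr//.
  by have := expR_ge1Dx (t / n%:R - 1); rewrite addrC subrK.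
apply: le_trans (ler_wpM2l (expR_ge0 _) h) _.
by rewrite mulrCA -expRD mulrC ler_wpM2r ?exprn_ge0 ?(ltW nR)// ler_expR; lra.
Qed.

Lemma expR1_ge : 9 / 4 <= expR 1 :> R.
Proof.
have -> : (1 : R) = 2^-1 * 2%:R by rewrite mulVf.
rewrite expRM_natr; have h := expR_ge1Dx (2^-1 : R).
have : (3 / 2) ^+ 2 <= expR (2^-1 : R) ^+ 2.
  by rewrite lerXn2r ?nnegrE ?expR_ge0//; lra.
by apply: le_trans; lra.
Qed.

Lemma bernoulli n (a : R) : 0 <= a -> 1 + n%:R * a <= (1 + a) ^+ n.
Proof.
move=> a0; elim: n => [|n IH]; first by rewrite mul0r addr0.
rewrite exprS; have h : 0 <= 1 + a by lra.
apply: le_trans (ler_wpM2l h IH).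
rewrite mulrDl mul1r mulrDr mulr1 -natr1 mulrDl mul1r.
have : 0 <= a * (n%:R * a) by rewrite !mulr_ge0.
lra.
Qed.

(** Chernoff's bound at twice the mean, (2 / e)^n, in a form weak enough for an
    elementary proof. It supplies the total mass of the Erlang density on
    [0, 2 n]. *)
Lemma erlang_double n : (0 < n)%N ->
  erlang_tail n.+1 (2 * n%:R) <= 8 / n%:R.
Proof.
move=> n0; have nR : 0 < n%:R :> R by rewrite ltr0n.
have h1 : expsum n.+1 (2 * n%:R) <= 2 ^+ n * expR n%:R.
  apply: le_trans (ler_wpM2l _ (expsum_le_expR n.+1 (ltW nR))); last first.
    by rewrite exprn_ge0.
  rewrite /expsum mulr_sumr ler_sum// => k _.
  rewrite exprMn -mulrA ler_wpM2r ?divr_ge0 ?exprn_ge0 ?(ltW nR)//.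
  by rewrite ler_eXn2l ?ltr1n// -ltnS.
apply: le_trans (ler_wpM2l (expR_ge0 _) h1) _.
have -> : expR (- (2 * n%:R)) * (2 ^+ n * expR n%:R) = (2 / expR (1 : R)) ^+ n.
  rewrite mulrCA -expRD expr_div_n -expRM_natr mul1r -expRN; congr (_ * expR _).
  ring.
have e1 := expR1_ge.
apply: (@le_trans _ _ ((8 / 9) ^+ n)).
  rewrite lerXn2r ?nnegrE ?divr_ge0 ?expR_ge0//.
  by rewrite ler_pdivrMr ?expR_gt0//; lra.
have -> : (8 / 9 : R) = (9 / 8)^-1 by rewrite invf_div.
rewrite exprVn -[8 / n%:R]invf_div lef_pV2 ?posrE ?exprn_gt0 ?divr_gt0//.
have -> : (9 / 8 : R) = 1 + 1 / 8 by lra.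
have := @bernoulli n (1/8); lra.
Qed.
End Erlang.

(** * The normal distribution function *)

Section Normal.
Context {R : realType}.
Implicit Types (x a b : R).
Local Notation mu := (@lebesgue_measure R).

Definition Phi x : R := fine (normal_prob (0 : R) 1 `]-oo, x]%classic).

(** The height 1 / sqrt (2 pi) of the standard normal density. *)
Definition phi0 : R := normal_peak 1.

Lemma normal_prob_Phi x : normal_prob (0 : R) 1 `]-oo, x]%classic = (Phi x)%:E.
Proof. by rewrite /Phi fineK// fin_num_measure. Qed.

Lemma Phi_ge0 x : 0 <= Phi x.
Proof. by rewrite /Phi fine_ge0. Qed.

Lemma Phi_le1 x : Phi x <= 1.
Proof. by rewrite -lee_fin -normal_prob_Phi probability_le1. Qed.

Lemma Phi_homo a b : a <= b -> Phi a <= Phi b.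
Proof.
move=> ab; rewrite -lee_fin -!normal_prob_Phi le_measure ?inE//.
exact: subitvPr.
Qed.

Lemma phi0_gt0 : 0 < phi0.
Proof. by rewrite normal_peak_gt0// oner_neq0. Qed.

Lemma phi0_le : phi0 <= 2^-1.
Proof.
rewrite /phi0 /normal_peak expr1n mul1r lef_pV2 ?posrE//; last first.
  by rewrite sqrtr_gt0 mulrn_wgt0// pi_gt0.
have -> : (2 : R) = Num.sqrt (2 ^+ 2) by rewrite sqrtr_sqr ger0_norm.
rewrite ler_sqrt; last by rewrite mulrn_wge0// pi_ge0.
by have := pi_ge2 R; rewrite -mulr_natr; lra.
Qed.

Lemma is_derive_Phi x : is_derive x 1 Phi (phi0 * expR (- (x ^+ 2 / 2))).
Proof.
have xx : x < x + 1 by rewrite ltrDl.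
have int : mu.-integrable `]-oo, (x + 1)] (EFin \o normal_pdf (0 : R) 1).
  apply: (@integrableS _ _ _ mu setT) => //.
  exact: integrable_normal_pdf.
have := @continuous_FTC1 R (normal_pdf 0 1) -oo%O x (x + 1) xx int.
move=> /(_ (ltNyr _)) [].
  by apply: continuous_normal_pdf; exact: oner_neq0.
move=> h1 h2; rewrite derive1E in h2.
have -> : phi0 * expR (- (x ^+ 2 / 2)) = normal_pdf (0 : R) 1 x.
  rewrite normal_pdfE ?oner_neq0// /normal_fun subr0 expr1n.
  by rewrite mulNr.
exact: DeriveDef.
Qed.

(** x^-2 is a crude majorant of the normal density, but its primitive is
    elementary and yields tails of order 1 / a, which is the precision
    needed at a = sqrt n. *)
Lemma gauss_le_inv x : x != 0 -> phi0 * expR (- (x ^+ 2 / 2)) <= x ^- 2.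
Proof.
move=> x0; have x2 : 0 < x ^+ 2 by rewrite exprn_even_gt0.
have h : expR (- (x ^+ 2 / 2)) <= 2 / x ^+ 2.
  rewrite expRN -[2 / _]invf_div lef_pV2 ?posrE ?expR_gt0 ?divr_gt0//.
  by have := expR_ge1Dx (x ^+ 2 / 2); lra.
apply: le_trans (ler_pM (ltW phi0_gt0) (expR_ge0 _) phi0_le h) _.
by rewrite mulrA mulVf// mul1r.
Qed.

Lemma is_derive_Ninv x : x != 0 -> is_derive x 1 (fun z : R => - z^-1) (x ^- 2).
Proof.
move=> x0; have d := @is_deriveV R id x 1 1 x0 (is_derive_id _ _).
by apply: is_derive_eq; rewrite /GRing.scale /=; field.
Qed.

Lemma Phi_increment a b : 0 < a * b -> a <= b -> Phi b - Phi a <= a^-1 - b^-1.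
Proof.
move=> ab0 ab.
have nz x : a <= x <= b -> x != 0.
  move=> /andP[ax xb]; apply/eqP => x0; move: ax xb; rewrite x0 => a0 b0.
  have : a * b <= 0 by rewrite mulr_le0_ge0.
  by rewrite leNgt ab0.
have nz' x : a < x < b -> x != 0.
  by move=> /andP[/ltW ax /ltW xb]; apply: nz; rewrite ax xb.
have := @derive_norm_le _ Phi _ (fun z : R => - z^-1) _ _ _ ab
  (fun x _ => is_derive_Phi x) (fun x _ => is_derive_continuous (is_derive_Phi x))
  (fun x h => is_derive_Ninv (nz' x h))
  (fun x h => is_derive_continuous (is_derive_Ninv (nz x h))) _.
move=> h; have : `|Phi b - Phi a| <= - b^-1 - - a^-1.
  apply: h => x /nz' x0; rewrite ger0_norm ?gauss_le_inv//.
  by rewrite mulr_ge0 ?expR_ge0// ltW// phi0_gt0.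
by have := ler_norm (Phi b - Phi a); lra.
Qed.

Lemma cvg_Phi_y : Phi n%:R @[n --> \oo] --> (1 : R).
Proof.
apply: fine_cvg.
pose F n := `]-oo, n%:R]%classic : set R.
have -> : 1%:E = normal_prob (0 : R) 1 (\bigcup_n F n).
  rewrite (_ : \bigcup_n F n = setT) ?probability_setT// -subTset => t _/=.
  by exists (Num.truncn t).+1; rewrite // /F /= in_itv/= ltW// truncnS_gt.
apply: nondecreasing_cvg_mu => //; first exact: bigcup_measurable.
move=> n m nm; apply/subsetPset => x; rewrite /F/= !in_itv/= => /le_trans.
by apply; rewrite ler_nat.
Qed.

Lemma cvg_Phi_Ny : Phi (- n%:R) @[n --> \oo] --> (0 : R).
Proof.
apply: fine_cvg.
pose F n := `]-oo, (- n%:R)]%classic : set R.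
have -> : 0%:E = normal_prob (0 : R) 1 (\bigcap_n F n).
  rewrite (_ : \bigcap_n F n = set0) ?measure0// -subset0 => t.
  move=> /(_ (Num.truncn (- t)).+1 I).
  by rewrite /F/= in_itv/= leNgt => /negP; apply; rewrite ltrNl truncnS_gt.
apply: nonincreasing_cvg_mu => //=.
- by rewrite (le_lt_trans (probability_le1 _ _)) ?ltry.
- exact: bigcap_measurable.
- move=> m n mn; apply/subsetPset => x; rewrite /F/= !in_itv/= => /le_trans; apply.
  by rewrite lerN2 ler_nat.
Qed.

Lemma Phi_upper_tail a : 0 < a -> 1 - Phi a <= a^-1.
Proof.
move=> a0; rewrite lerBlDr; apply: (ler_cvg_to cvg_Phi_y (cvg_cst (a^-1 + Phi a))).
near=> n; have an : a <= n%:R by near: n; exact: nbhs_infty_ger.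
have n0 : 0 < n%:R :> R by apply: lt_le_trans an.
have := Phi_increment (mulr_gt0 a0 n0) an.
have : 0 < n%:R^-1 :> R by rewrite invr_gt0.
lra.
Unshelve. all: by end_near. Qed.

Lemma Phi_lower_tail a : 0 < a -> Phi (- a) <= a^-1.
Proof.
move=> a0; rewrite -subr_le0.
apply: (ler_cvg_to (cvg_cst (Phi (- a) - a^-1)) cvg_Phi_Ny).
near=> n; have an : a <= n%:R by near: n; exact: nbhs_infty_ger.
have n0 : 0 < n%:R :> R by apply: lt_le_trans an.
have := @Phi_increment (- n%:R) (- a).
rewrite mulrNN mulr_gt0// lerN2 => /(_ isT an); rewrite !invrN.
have : 0 < n%:R^-1 :> R by rewrite invr_gt0.
lra.
Unshelve. all: by end_near. Qed.
End Normal.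

(** * Normal approximation of the Erlang distribution *)

Section ErlangCLT.
Context {R : realType}.
Implicit Types (x : R) (n : nat).

(** The 4 * 18 ^+ 3 is half of the constant 2 * 18 ^+ 3 of [gauss_approx]
    (from [phi0_le]) times the bound 4 on the total variation of atan; the
    2 collects the two normal tails beyond - sqrt n and sqrt n. *)
Definition clt_const : R := 2 + 4 * 18 ^+ 3.

(** The distribution function of (S - n) / s for a sum S of n.+1 independent
    standard exponential variables. With n.+1 terms the mode of the
    density is exactly n, so the exponent at n + x s has no linear term. The
    scale s is a parameter characterised by s ^+ 2 = n. *)
Definition erlang_cdf n (s : R) x : R := 1 - erlang_tail n.+1 (n%:R + x * s).

(** The Erlang density at its mode, on the scale of x, relative to the normal
    density at 0. *)
Definition peak_ratio n (s : R) : R := s * pois n n%:R / phi0.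

Section FixedIndex.
Variables (n : nat) (s : R).
Hypotheses (n_gt0 : (0 < n)%N) (s0 : 0 < s) (s2 : s ^+ 2 = n%:R).
Let s1 : 1 <= s.
Proof. by rewrite -(@ler_pXn2r _ 2) ?nnegrE ?(ltW s0)// expr1n s2 ler1n. Qed.

Local Notation k := (peak_ratio n s).
Local Notation K := (pois n (n%:R : R)).
Let K0 : 0 <= K. Proof. exact: pois_ge0. Qed.

Lemma pois_scaled x : - s < x ->
  pois n (n%:R + x * s) = K * expR (s ^+ 2 * (ln (1 + x / s) - x / s)).
Proof.
move=> xs; have y0 : 0 < 1 + x / s.
  by rewrite -ltrBlDl sub0r ltr_pdivlMr// mulN1r.
have -> : n%:R + x * s = s ^+ 2 * (1 + x / s).
  by rewrite -s2; field; rewrite gt_eqF.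
rewrite /pois -s2 exprMn mulrBr expRD.
have -> : expR (s ^+ 2 * ln (1 + x / s)) = (1 + x / s) ^+ n.
  by rewrite s2 mulrC expRM_natr lnK ?posrE.
have -> : - (s ^+ 2 * (1 + x / s)) = - s ^+ 2 + - (s ^+ 2 * (x / s)) by ring.
rewrite expRD; ring.
Qed.

Lemma is_derive_erlang_cdf x :
  is_derive x 1 (erlang_cdf n s) (s * pois n (n%:R + x * s)).
Proof.
have d1 : is_derive x 1 (fun z : R => n%:R + z * s) s.
  have : is_derive x 1 (cst n%:R + (s \*: id) : R -> R) (0 + s *: 1).
    exact: is_deriveD.
  rewrite add0r /GRing.scale /= mulr1; congr is_derive.
  by apply/funext => z; rewrite fctE /= /GRing.scale /= mulrC.
have d2 := @is_derive1_compR _ (erlang_tail n.+1) (fun z : R => n%:R + z * s)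
  x _ _ (is_derive_erlang n (n%:R + x * s)) d1.
have := is_deriveB (is_derive_cst (1 : R) x 1) d2.
by rewrite sub0r mulNr opprK mulrC.
Qed.

(** The two densities, with the normal one rescaled to the same peak, differ by
    at most a multiple of 1 / (1 + x^2), the derivative of atan. *)
Lemma erlang_cdf_compare x : - s <= x <= s ->
  `|(erlang_cdf n s x - peak_ratio n s * Phi x)
    - (erlang_cdf n s (- s) - peak_ratio n s * Phi (- s))|
  <= 2 * 18 ^+ 3 * K * (atan x - atan (- s)).
Proof.
move=> /andP[sx xs].
have [f [fE df]] : exists f : R -> R,
    (forall z, f z = erlang_cdf n s z - k * Phi z) /\
    (forall z : R, is_derive z 1 f
      (s * pois n (n%:R + z * s) - k * (phi0 * expR (- (z ^+ 2 / 2))))).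
  exists (fun z => erlang_cdf n s z - k * Phi z); split=> [//|z].
  have d1 := is_derive_erlang_cdf z; have d2 := is_derive_Phi z.
  by apply: is_derive_eq; rewrite /GRing.scale /=; ring.
have [g [gE dg]] : exists g : R -> R,
    (forall z, g z = 2 * 18 ^+ 3 * K * atan z) /\
    (forall z : R, is_derive z 1 g (2 * 18 ^+ 3 * K * (1 + z ^+ 2)^-1)).
  exists (fun z => 2 * 18 ^+ 3 * K * atan z); split=> [//|z].
  have d1 := is_derive1_atan z.
  by apply: is_derive_eq; rewrite /GRing.scale /=; ring.
rewrite mulrBr -!fE -!gE.
apply: (derive_norm_le sx (fun z _ => df z) _ (fun z _ => dg z)) => z /andP[sz zx].
- exact: (is_derive_continuous (df z)).
- exact: (is_derive_continuous (dg z)).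
have -> : k * (phi0 * expR (- (z ^+ 2 / 2))) = s * K * expR (- (z ^+ 2 / 2)).
  by rewrite mulrA /peak_ratio divfK ?gt_eqF ?phi0_gt0.
rewrite pois_scaled// mulrA -mulrBr normrM ger0_norm ?mulr_ge0 ?(ltW s0)//.
have -> : 2 * 18 ^+ 3 * K * (1 + z ^+ 2)^-1 =
    s * K * (2 * 18 ^+ 3 / s * (1 + z ^+ 2)^-1).
  field; rewrite !gt_eqF//=.
  by have := sqr_ge0 z; lra.
rewrite ler_wpM2l ?mulr_ge0// ?(ltW s0)// gauss_approx// sz.
by rewrite (ltW (lt_le_trans zx xs)).
Qed.

Lemma erlang_cdfN : erlang_cdf n s (- s) = 0.
Proof.
rewrite /erlang_cdf (_ : _ + _ = 0) ?erlang0 ?subrr//.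
by rewrite mulNr -expr2 s2 subrr.
Qed.


Let k0 : 0 <= k.
Proof. by rewrite divr_ge0 ?mulr_ge0// ?ltW ?phi0_gt0. Qed.

Let Kk : K = k * phi0 / s.
Proof. by rewrite /peak_ratio divfK ?gt_eqF ?phi0_gt0// mulrC mulKf ?gt_eqF. Qed.

Local Notation N := clt_const.

Lemma erlang_cdf_near_multiple x : - s <= x <= s ->
  `|erlang_cdf n s x - k * Phi x| <= k * (N - 1) / s.
Proof.
move=> xs; have := erlang_cdf_compare xs; rewrite erlang_cdfN sub0r opprK.
set u := _ - _ * Phi x => h.
have h2 : k * Phi (- s) <= k / s by rewrite ler_wpM2l// Phi_lower_tail.
have h3 : 2 * 18 ^+ 3 * K * (atan x - atan (- s)) <= k * (4 * 18 ^+ 3) / s.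
  have -> : k * (4 * 18 ^+ 3) / s = 2 * 18 ^+ 3 * (k * 2^-1 / s) * 4.
    by field; rewrite gt_eqF.
  apply: ler_pM.
  - by rewrite !mulr_ge0.
  - by rewrite subr_ge0 le_atan//; lra.
  - rewrite ler_wpM2l// Kk ler_wpM2r ?invr_ge0 ?(ltW s0)//.
    by rewrite ler_wpM2l// phi0_le.
  - have := pihalf_lt2 R.
    by have := atan_ltpi2 x; have := atan_gtNpi2 (- s); lra.
have h4 : 0 <= k * Phi (- s) by rewrite mulr_ge0// Phi_ge0.
have -> : k * (N - 1) / s = k / s + k * (4 * 18 ^+ 3) / s.
  by rewrite /clt_const; field; rewrite gt_eqF.
move: h; rewrite !ler_norml => /andP[h h'].
by apply/andP; split; lra.
Qed.

Let erlang_arg_ge0 x : - s <= x -> 0 <= n%:R + x * s.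
Proof.
move=> sx; rewrite -s2 expr2 -mulrDl mulr_ge0 ?(ltW s0)//; lra.
Qed.

Lemma erlang_cdf_le1 x : - s <= x -> erlang_cdf n s x <= 1.
Proof.
move=> sx; rewrite /erlang_cdf gerBl erlang_ge0//.
exact: erlang_arg_ge0.
Qed.

Lemma erlang_cdf_ge0 x : - s <= x -> 0 <= erlang_cdf n s x.
Proof.
move=> sx; rewrite /erlang_cdf subr_ge0 erlang_le1//.
exact: erlang_arg_ge0.
Qed.

Lemma erlang_cdf_homo x y : - s <= x -> x <= y ->
  erlang_cdf n s x <= erlang_cdf n s y.
Proof.
move=> sx xy; rewrite /erlang_cdf lerD2l lerN2 erlang_homo//.
  exact: erlang_arg_ge0.
by rewrite lerD2l ler_wpM2r// ltW.
Qed.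

Lemma erlang_cdf_s : 1 - 8 / s <= erlang_cdf n s s.
Proof.
rewrite /erlang_cdf lerD2l lerN2.
have -> : n%:R + s * s = 2 * n%:R by rewrite -expr2 s2; ring.
apply: le_trans (erlang_double n_gt0) _; rewrite ler_wpM2l//.
rewrite lef_pV2 ?posrE ?ltr0n//.
by rewrite -s2 expr2 ler_peMl// ltW.
Qed.

(** Evaluate the previous comparison at x = s, where both distribution
    functions are within O(1 / s) of 1: the common normalisation determines
    the ratio of the peaks. *)
Lemma peak_ratio_near1 : `|1 - k| <= 8 / s + k * N / s.
Proof.
have ss : - s <= s <= s by rewrite lexx andbT ge0_cp// ltW.
have := erlang_cdf_near_multiple ss; have := erlang_cdf_s.
have /andP[sNs _] := ss; have := erlang_cdf_le1 sNs.
have := Phi_upper_tail s0; have := Phi_le1 s.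
have -> : k * N / s = k * (N - 1) / s + k * s^-1.
  by field; rewrite gt_eqF.
move: (Phi s) => P P1 P2 F1 F2.
have : 0 <= k * (1 - P) by rewrite mulr_ge0// subr_ge0.
have : k * (1 - P) <= k * s^-1 by rewrite ler_wpM2l.
rewrite mulrBr mulr1 => ? ?.
rewrite !ler_norml => /andP[? ?].
apply/andP; split; lra.
Qed.

Lemma peak_ratio_le4 : 2 * N <= s -> k <= 4.
Proof.
move=> Ns; have := peak_ratio_near1; rewrite ler_norml => /andP[h _].
have h8 : 8 / s <= 1 by rewrite ler_pdivrMr//; rewrite /clt_const in Ns; lra.
have : k * N / s <= k / 2.
  rewrite -mulrA ler_wpM2l// ler_pdivrMr//; lra.
lra.
Qed.

Lemma clt_const_ge1 : 1 <= N. Proof. by rewrite /clt_const; lra. Qed.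

(** For small s the bound exceeds 1 and holds trivially; the case distinction
    avoids asymptotics in n. *)
Lemma pois_peak_le : pois n n%:R <= 2 * N / s.
Proof.
have N1 := clt_const_ge1.
have [Ns|Ns] := leP (2 * N) s; last first.
  apply: (@le_trans _ _ 1); first exact: pois_le1.
  by rewrite ler_pdivlMr// mul1r ltW.
rewrite Kk ler_wpM2r ?invr_ge0 ?(ltW s0)//.
apply: le_trans (ler_pM k0 (ltW phi0_gt0) (peak_ratio_le4 Ns) phi0_le) _.
lra.
Qed.

Lemma erlang_cdf_normal x : - s <= x ->
  `|erlang_cdf n s x - Phi x| <= 8 * (N + 1) / s.
Proof.
move=> sx; have N1 := clt_const_ge1; have is0 : 0 < s^-1 by rewrite invr_gt0.
have F1 := erlang_cdf_le1 sx; have F0 := erlang_cdf_ge0 sx.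
have P0 := Phi_ge0 x; have P1 := Phi_le1 x.
have [Ns|Ns] := leP (2 * N) s; last first.
  apply: (@le_trans _ _ 1); last by rewrite ler_pdivlMr//; lra.
  by rewrite ler_norml; apply/andP; split; lra.
have k4 := peak_ratio_le4 Ns.
have [xs|xs] := leP x s; last first.
  have := erlang_cdf_s; have := Phi_upper_tail s0.
  have ss : - s <= s by rewrite ge0_cp// ltW.
  have := Phi_homo (ltW xs); have := erlang_cdf_homo ss (ltW xs).
  have : 8 * (N + 1) / s = 8 / s + 8 * N * s^-1.
    by field; rewrite gt_eqF.
  have : 0 <= 8 * N * s^-1 by rewrite !mulr_ge0// ?ltW//; lra.
  by move=> *; rewrite ler_norml; apply/andP; split; lra.
have := @erlang_cdf_near_multiple x; rewrite sx xs => /(_ isT).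
have := peak_ratio_near1; rewrite !ler_norml => /andP[h1 h2] /andP[h3 h4].
have h5 : k * N / s <= 4 * N / s.
  by rewrite ler_wpM2r ?(ltW is0)// ler_wpM2r//; lra.
have h6 : k * (N - 1) / s <= 4 * N / s.
  apply: le_trans h5; rewrite ler_wpM2r ?(ltW is0)// ler_wpM2l//; lra.
have h7 : 0 <= 4 * N / s by rewrite !mulr_ge0 ?(ltW is0)//; lra.
have -> : 8 * (N + 1) / s = 8 / s + 4 * N / s + 4 * N / s.
  by field; rewrite gt_eqF.
have h8 : 0 <= 8 / s by rewrite mulr_ge0// ltW.
have b1 : - (8 / s + 4 * N / s) <= (k - 1) * Phi x.
  rewrite -[leLHS]mulr1; apply: (@le_trans _ _ (- (8 / s + 4 * N / s) * Phi x)).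
    by rewrite !mulNr lerN2 ler_wpM2l// addr_ge0.
  by rewrite ler_wpM2r//; lra.
have b2 : (k - 1) * Phi x <= 8 / s + 4 * N / s.
  apply: (@le_trans _ _ ((8 / s + 4 * N / s) * Phi x)).
    by rewrite ler_wpM2r//; lra.
  by rewrite -[leRHS]mulr1 ler_wpM2l// addr_ge0.
rewrite mulrBl mul1r in b1 b2.
by apply/andP; split; lra.
Qed.

End FixedIndex.
End ErlangCLT.

(** * Increments of truncated exponential sums *)

Section ExpsumSteps.
Context {R : realType}.
Implicit Types (t u : R) (n : nat).

Lemma erlang_nonincreasing n t u : 0 <= t -> t <= u ->
  erlang_tail n u <= erlang_tail n t.
Proof.
case: n => [|n]; last exact: erlang_homo.
by rewrite /erlang_tail /expsum !big_ord0 !mulr0.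
Qed.

Lemma expsum_homo n t u : 0 <= t -> t <= u -> expsum n t <= expsum n u.
Proof.
move=> t0 tu; apply: ler_sum => k _; rewrite ler_wpM2r// lerXn2r// ?nnegrE//.
exact: le_trans tu.
Qed.

(** On [t, u] the derivative of [expsum n.+1] is [expsum n], which is
    e^x [erlang_tail n x] with a nonincreasing second factor; replace that
    factor by its value at u and integrate e^x. *)
Lemma expsum_exp_step n t u : 0 <= t -> t <= u ->
  expsum n.+1 t + (1 - expR (t - u)) * expsum n u <= expsum n.+1 u.
Proof.
move=> t0 tu; pose c := erlang_tail n u.
pose f x := expsum n.+1 x - c * expR x.
have df (x : R) : is_derive x 1 f (expsum n x - c * expR x).
  have d1 := is_derive_expsum n x; have d2 := is_derive_expR x.
  by rewrite /f; apply: is_derive_eq; rewrite /GRing.scale /=; ring.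
have : f t <= f u.
  clearbody f; apply: (derive_ge0_le tu (fun x _ => df x)) => x /andP[tx xu].
    exact: (is_derive_continuous (df x)).
  rewrite subr_ge0 -ler_pdivlMr ?expR_gt0// mulrC -expRN.
  by apply: erlang_nonincreasing; lra.
rewrite /f /c /erlang_tail => h.
have e1 : expR (- u) * expsum n u * expR u = expsum n u.
  by rewrite mulrAC -expRD addNr expR0 mul1r.
have e2 : expR (- u) * expsum n u * expR t = expR (t - u) * expsum n u.
  by rewrite mulrAC -expRD addrC.
rewrite e1 e2 in h; lra.
Qed.

(** On [t, u] the derivative [expsum n] is at most its value at u. *)
Lemma expsum_lin_step n t u : 0 <= t -> t <= u ->
  expsum n.+1 u <= expsum n.+1 t + (u - t) * expsum n u.
Proof.
move=> t0 tu; pose c := expsum n u.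
pose f x := c * x - expsum n.+1 x.
have df (x : R) : is_derive x 1 f (c - expsum n x).
  have d1 := is_derive_expsum n x.
  by rewrite /f; apply: is_derive_eq; rewrite /GRing.scale /=; ring.
have : f t <= f u.
  clearbody f; apply: (derive_ge0_le tu (fun x _ => df x)) => x /andP[tx xu].
    exact: (is_derive_continuous (df x)).
  by rewrite subr_ge0 expsum_homo//; lra.
rewrite /f /c; lra.
Qed.

(** Each further exponential variable adds one Poisson weight, at most the peak
    weight of order 1 / sqrt n. *)
Lemma erlang_increment n i (t : R) : (0 < n)%N -> 0 <= t ->
  erlang_tail (n + i) t - erlang_tail n t <= i%:R * (2 * clt_const / Num.sqrt n%:R).
Proof.
move=> n0 t0; elim: i => [|i IH]; first by rewrite addn0 subrr mul0r.
have ni : (0 < n + i)%N by lia.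
have s2 k : Num.sqrt (k%:R : R) ^+ 2 = k%:R by rewrite sqr_sqrtr.
have s0 k : (0 < k)%N -> 0 < Num.sqrt (k%:R : R).
  by move=> k0; rewrite sqrtr_gt0 ltr0n.
have p := le_trans (pois_peak ni t0) (pois_peak_le ni (s0 _ ni) (s2 _)).
have c0 : 0 <= 2 * clt_const :> R.
  by rewrite mulr_ge0//; have := @clt_const_ge1 R; lra.
have q :
    2 * clt_const / Num.sqrt (n + i)%:R <= 2 * clt_const / Num.sqrt n%:R :> R.
  rewrite ler_wpM2l// lef_pV2 ?posrE ?s0// ler_sqrt// ler_nat leq_addr//.
rewrite addnS erlangS -natr1 mulrDl mul1r.
have := le_trans p q; lra.
Qed.

Lemma ln_ge_two_thirds n : (3 <= n)%N -> 2 / 3 <= ln n%:R :> R.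
Proof.
move=> n3; apply: (@le_trans _ _ (ln 3)).
  rewrite -[3]invrK lnV ?posrE// -[3^-1](subrKC 1).
  have := @le_ln1Dx R (3^-1 - 1); lra.
by rewrite ler_ln ?posrE ?ltr0n ?ler_nat//; lia.
Qed.

Lemma erlang_lipschitz n t u : (0 < n)%N -> 0 <= t -> t <= u ->
  erlang_tail n.+1 t - erlang_tail n.+1 u <=
    (u - t) * (2 * clt_const / Num.sqrt n%:R).
Proof.
move=> n0 t0 tu; set c := 2 * clt_const / Num.sqrt n%:R.
pose f z := z * c + erlang_tail n.+1 z.
have df (x : R) : is_derive x 1 f (c - pois n x).
  have d1 := is_derive_erlang n x.
  by rewrite /f; apply: is_derive_eq; rewrite /GRing.scale /=; ring.
have : f t <= f u.
  clearbody f; apply: (derive_ge0_le tu (fun x _ => df x)) => x /andP[tx xu].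
    exact: (is_derive_continuous (df x)).
  have x0 : 0 <= x by lra.
  rewrite subr_ge0 (le_trans (pois_peak n0 x0))//.
  by apply: pois_peak_le; rewrite ?sqrtr_gt0 ?ltr0n// sqr_sqrtr.
rewrite /f; lra.
Qed.

End ExpsumSteps.

(** * The recursion for the tails of the digits *)

Lemma downward_ind (P : nat -> Prop) K : P K ->
  (forall j, (0 < j < K)%N -> P j.+1 -> P j) ->
  forall j, (0 < j <= K)%N -> P j.
Proof.
move=> PK PS j /andP[j0 jK].
have [i iE] : exists i, (j + i = K)%N by exists (K - j)%N; rewrite subnKC.
elim: i j j0 jK iE => [|i IH] j j0 jK iE; first by rewrite -(addn0 j) iE.
by apply: PS; [lia|apply: IH; lia].
Qed.

(** In this section [b n j] stands for the length of the set of x in (0, 1/j]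
    whose n-th digit exceeds m, and only its recursion is used. The value at
    n = 0 describes a chain that has not moved from j. The probability that
    the chain started at j exceeds m after n steps is [j * b n j]. *)
Section Recursion.
Context {R : realType}.
Variables (m : nat) (b : nat -> nat -> R).
Hypothesis m_gt0 : (0 < m)%N.
Hypothesis b0 : forall j, (0 < j < m)%N -> b 0 j = 0.
Hypothesis bm : forall n, b n m = m%:R^-1.
Hypothesis bS : forall n j, (0 < j < m)%N ->
  b n.+1 j = b n.+1 j.+1 + b n j / j.+1%:R.

Let m0 : 0 < m%:R :> R. Proof. by rewrite ltr0n. Qed.

Lemma tail_rec_ge0 n j : (0 < j <= m)%N -> 0 <= b n j.
Proof.
elim: n j => [|n IH] j.
  move=> /andP[j0]; rewrite leq_eqVlt => /predU1P[->|jm].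
    by rewrite bm invr_ge0.
  by rewrite b0// j0.
move: j; apply: downward_ind => //; first by rewrite bm invr_ge0.
by move=> j jm IHj; rewrite bS// addr_ge0// divr_ge0// IH//; lia.
Qed.

Lemma tail_rec_nondecreasing n j : (0 < j <= m)%N -> b n j <= b n.+1 j.
Proof.
elim: n j => [|n IH] j.
  move=> /andP[j0]; rewrite leq_eqVlt => /predU1P[->|jm]; first by rewrite !bm.
  by rewrite b0 ?j0// tail_rec_ge0// j0 ltnW.
move: j; apply: downward_ind => //; first by rewrite !bm.
move=> j jm IHj; rewrite [b n.+1 j]bS// [b n.+2 j]bS// lerD//.
by rewrite ler_wpM2r// IH//; lia.
Qed.

Lemma tail_rec_nondecreasingD n i j : (0 < j <= m)%N -> b n j <= b (n + i) j.
Proof.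
move=> jm; elim: i => [|i IH]; first by rewrite addn0.
by rewrite addnS (le_trans IH)// tail_rec_nondecreasing.
Qed.

(** One step of the recursion adds b n j / (j+1), and 1 / (j+1) is
    1 - e^(t - u) for t = ln (m / (j+1)) and u = ln (m / j), which is the
    increment allowed by [expsum_exp_step]. The index n.+1 is needed because
    at n = 0 and j = m the left-hand side is 1 and the right-hand side 0. *)
Lemma tail_rec_le_expsum n j : (0 < j <= m)%N ->
  m%:R * b n.+1 j <= expsum n.+1 (ln (m%:R / j%:R)).
Proof.
have base k : m%:R * b k.+1 m <= expsum k.+1 (ln (m%:R / m%:R)).
  by rewrite bm divff ?gt_eqF// ln1 expsum0.
have step k :
    (forall j, (0 < j < m)%N ->
      m%:R * b k j <= expsum k (ln (m%:R / j%:R))) ->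
    forall j, (0 < j <= m)%N ->
      m%:R * b k.+1 j <= expsum k.+1 (ln (m%:R / j%:R)).
  move=> IHk; apply: downward_ind => // i im IHi.
  have [i0 iltm] := andP im.
  have iR : 0 < i%:R :> R by rewrite ltr0n.
  rewrite bS// mulrDr.
  set t := ln (m%:R / i.+1%:R) in IHi; set u := ln (m%:R / i%:R).
  have t0 : 0 <= t by rewrite ln_ge0// ler_pdivlMr// mul1r ler_nat.
  have tuE : expR (t - u) = i%:R / i.+1%:R.
    by rewrite expRB !lnK ?posrE ?divr_gt0//; field; rewrite !gt_eqF//= addrC natr1.
  have tu : t <= u.
    rewrite -subr_le0 -ler_expR tuE expR0 ler_pdivrMr// mul1r ler_nat//.
  apply: le_trans (expsum_exp_step k t0 tu); rewrite lerD// tuE.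
  have -> : 1 - i%:R / i.+1%:R = i.+1%:R^-1 :> R.
    by rewrite -natr1; field; rewrite natr1.
  by rewrite mulrA mulrC ler_wpM2l// IHk.
elim: n j => [|n IH] j; apply: step => i im.
  by rewrite b0// mulr0 /expsum big_ord0.
by apply: IH; lia.
Qed.

Definition harmonic_tail j : R := \sum_(j <= i < m) i.+1%:R^-1.

Lemma harmonic_tailS j : (j < m)%N ->
  harmonic_tail j = harmonic_tail j.+1 + j.+1%:R^-1.
Proof. by move=> jm; rewrite /harmonic_tail big_ltn// addrC. Qed.

Lemma harmonic_tailm : harmonic_tail m = 0.
Proof. by rewrite /harmonic_tail big_geq. Qed.

Lemma harmonic_tail_ge0 j : 0 <= harmonic_tail j.
Proof. by apply: sumr_ge0 => i _. Qed.

(** Here the step 1 / (j+1) is the increment of the argument itself, so that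
    [expsum_lin_step] applies and harmonic sums replace logarithms. *)
Lemma expsum_le_tail_rec n j : (0 < j <= m)%N ->
  expsum n (harmonic_tail j) <= m%:R * b n j.
Proof.
elim: n j => [|n IH] j.
  by move=> jm; rewrite /expsum big_ord0 mulr_ge0// tail_rec_ge0.
move: j; apply: downward_ind => //.
  by rewrite harmonic_tailm bm expsum0 divff// gt_eqF.
move=> j jm IHj; rewrite bS// mulrDr harmonic_tailS; last by case/andP: jm.
have h := @expsum_lin_step R n (harmonic_tail j.+1)
  (harmonic_tail j.+1 + j.+1%:R^-1).
apply: le_trans (h _ _) _; first exact: harmonic_tail_ge0.
  by rewrite lerDl.
rewrite lerD// addrAC subrr add0r mulrA [leRHS]mulrC ler_wpM2l//.
by rewrite -harmonic_tailS; [apply: IH; lia|case/andP: jm].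
Qed.

Lemma expR_harmonic_le j : (0 < j <= m)%N ->
  expR (harmonic_tail j) * j%:R <= m%:R.
Proof.
move: j; apply: downward_ind => //.
  by rewrite harmonic_tailm expR0 mul1r.
move=> j /andP[j0 jm] IH; rewrite harmonic_tailS// expRD -mulrA.
apply: le_trans IH; rewrite ler_wpM2l ?expR_ge0//.
have h : 1 - j.+1%:R^-1 <= expR (- j.+1%:R^-1 : R) by exact: expR_ge1Dx.
have h2 : 1 - j.+1%:R^-1 = j%:R / j.+1%:R :> R.
  by rewrite -natr1; field; rewrite natr1.
rewrite h2 expRN ler_pdivrMr// mulrC ler_pdivlMr ?expR_gt0// in h.
by rewrite mulrC.
Qed.

Lemma expR_harmonic_ge j : (0 < j <= m)%N ->
  m.+1%:R <= expR (harmonic_tail j) * j.+1%:R.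
Proof.
move: j; apply: downward_ind => //.
  by rewrite harmonic_tailm expR0 mul1r.
move=> j /andP[j0 jm] IH; rewrite harmonic_tailS// expRD -mulrA.
apply: (le_trans IH); rewrite ler_wpM2l ?expR_ge0//.
rewrite -ler_pdivrMr//; apply: le_trans (expR_ge1Dx _).
have -> // : 1 + j.+1%:R^-1 = j.+2%:R / j.+1%:R :> R.
by rewrite -[j.+2%:R]natr1; field.
Qed.

Lemma tail_rec_le_inv n j : (0 < j <= m)%N -> j%:R * b n j <= 1.
Proof.
case/andP; case: n => [|n] j0.
  rewrite leq_eqVlt => /predU1P[->|jm]; first by rewrite bm divff// gt_eqF.
  by rewrite b0 ?j0// mulr0.
move=> jm; have j0R : 0 < j%:R :> R by rewrite ltr0n.
have jmR : j%:R <= m%:R :> R by rewrite ler_nat.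
have := @tail_rec_le_expsum n j; rewrite j0 jm => /(_ isT) h.
have := le_trans h (expsum_le_expR n.+1 (ln_ge0 _)).
rewrite ler_pdivlMr// mul1r => /(_ jmR).
rewrite lnK ?posrE ?divr_gt0// -ler_pdivlMl// mulrA mulVf ?gt_eqF// mul1r => bj.
by rewrite mulrC -ler_pdivlMr// div1r.
Qed.

(** The chain started at j <= K does at least as well as the chain started at
    K with i steps less, unless it is still below K after i steps. The factor
    K / j * (2/3)^i is a supersolution of the recursion: at a step from j it
    reduces to 3 / (2 j (j+1)) + j / (j+1)^2 <= 1 / j, true for j >= 1. In
    probabilistic terms K / j bounds the expectation of (3/2)^W, where W is the
    time spent below K. *)
Lemma tail_rec_start_level n i K j : (0 < j <= K)%N -> (K <= m)%N ->
  K%:R * b n K - K%:R / j%:R * (2 / 3) ^+ i <= j%:R * b (n + i) j.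
Proof.
move=> jK Km; have Kgt0 : (0 < K <= m)%N by rewrite Km; lia.
have [K0 _] := andP Kgt0; have KR : 0 < K%:R :> R by rewrite ltr0n.
pose P := K%:R * b n K; rewrite -/P.
have P1 : P <= 1 by exact: tail_rec_le_inv.
have th0 k : 0 <= (2 / 3 : R) ^+ k by rewrite exprn_ge0//; lra.
move: j jK i; apply: downward_ind.
  move=> i; apply: (@le_trans _ _ P).
    by rewrite gerBl mulr_ge0// divr_ge0.
  by rewrite /P ler_wpM2l// tail_rec_nondecreasingD.
move=> j jK IH; have [j0 jltK] := andP jK.
have jR : 0 < j%:R :> R by rewrite ltr0n.
have jm : (0 < j < m)%N by lia.
elim=> [|i IHi].
  apply: (@le_trans _ _ 0); last by rewrite mulr_ge0// tail_rec_ge0//; lia.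
  rewrite expr0 mulr1 subr_le0; apply: (le_trans P1).
  by rewrite ler_pdivlMr// mul1r ler_nat; lia.
rewrite addnS bS//; have := IH i.+1; rewrite addnS.
move: IHi; set x := b (n + i) j; set y := b _ j.+1; set t := (2 / 3) ^+ i.
rewrite exprS -/t => h1 h2.
have t0 : 0 <= t by exact: th0.
have j1 : 1 <= j%:R :> R by rewrite ler1n.
rewrite -natr1 in h2 *; set J := j%:R in jR h1 h2 j1 *.
have J1 : 0 < J + 1 by lra.
have -> : J * (y + x / (J + 1)) =
    J / (J + 1) * ((J + 1) * y) + (J + 1)^-1 * (J * x).
  by field; rewrite gt_eqF.
have h1' := ler_wpM2l (ltW (divr_gt0 jR J1)) h2.
have h2' : (J + 1)^-1 * (P - K%:R / J * t) <= (J + 1)^-1 * (J * x).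
  by rewrite ler_wpM2l// invr_ge0 ltW.
apply: le_trans (lerD h1' h2'); rewrite -subr_ge0.
have -> : J / (J + 1) * (P - K%:R / (J + 1) * (2 / 3 * t)) +
    (J + 1)^-1 * (P - K%:R / J * t) - (P - K%:R / J * (2 / 3 * t)) =
    K%:R * t * (2 / 3) * (J - 1) / 2 / (J * (J + 1) ^+ 2).
  by field; rewrite !gt_eqF.
rewrite !mulr_ge0 ?invr_ge0 ?mulr_ge0 ?exprn_ge0//; lra.
Qed.

Lemma tail_rec_le_erlang n : b n.+1 1 <= erlang_tail n.+1 (ln m%:R).
Proof.
have := @tail_rec_le_expsum n 1; rewrite m_gt0 divr1 => /(_ isT).
by rewrite /erlang_tail expRN lnK ?posrE// -ler_pdivlMl.
Qed.

(** The factor (K / m) e^(H_m - H_K) is at least K (m+1) / (m (K+1)), hence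
    the loss of 1 / K. In the Erlang tail the argument H_m - H_K may be replaced
    by the larger ln m, since tails decrease. *)
Lemma erlang_le_tail_rec_above n i K : (0 < K <= m)%N ->
  erlang_tail n (ln m%:R) - K%:R^-1 - K%:R * (2 / 3) ^+ i <= b (n + i) 1.
Proof.
move=> Km; have [K0 Klem] := andP Km; have KR : 0 < K%:R :> R by rewrite ltr0n.
have := @tail_rec_start_level n i K 1; rewrite K0 Klem divr1 mul1r => /(_ isT isT).
apply: le_trans; rewrite lerD2r.
set t := harmonic_tail K; have t0 : 0 <= t by exact: harmonic_tail_ge0.
have up := expR_harmonic_le Km; have lo := expR_harmonic_ge Km.
rewrite -/t in up lo.
have tle : t <= ln m%:R.
  rewrite -ler_expR lnK ?posrE//; apply: le_trans up.
  by rewrite ler_peMr ?expR_ge0// ler1n.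
have lm0 := le_trans t0 tle.
have e0 := erlang_ge0 n lm0; have e1 := erlang_le1 n lm0.
have h1 : K%:R / m%:R * expsum n t <= K%:R * b n K.
  rewrite -mulrA ler_wpM2l// ler_pdivrMl//; exact: expsum_le_tail_rec.
apply: le_trans h1.
have -> : expsum n t = expR t * erlang_tail n t.
  by rewrite /erlang_tail mulrA -expRD subrr expR0 mul1r.
have h2 : K%:R / K.+1%:R <= K%:R / m%:R * expR t.
  rewrite -mulrA ler_wpM2l// mulrC ler_pdivlMr// mulrC ler_pdivrMr//.
  by apply: le_trans lo; rewrite ler_nat.
have h3 : 1 - K%:R^-1 <= K%:R / K.+1%:R :> R.
  rewrite -subr_ge0 -natr1.
  have -> : K%:R / (K%:R + 1) - (1 - K%:R^-1) = (K%:R * (K%:R + 1))^-1 :> R.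
    by field; rewrite natr1 !gt_eqF.
  by rewrite invr_ge0 mulr_ge0// ltW//; lra.
rewrite mulrA; apply: (@le_trans _ _ (K%:R / m%:R * expR t * erlang_tail n (ln m%:R))).
  apply: (@le_trans _ _ ((1 - K%:R^-1) * erlang_tail n (ln m%:R))).
    rewrite mulrBl mul1r lerD2l lerN2.
    by rewrite ler_piMr// invr_ge0 ltW.
  by rewrite ler_wpM2r// (le_trans h3).
by rewrite ler_wpM2l//; exact: erlang_nonincreasing.
Qed.

Lemma erlang_le_tail_rec n i K : (0 < K)%N ->
  erlang_tail n (ln m%:R) - K%:R^-1 - K%:R * (2 / 3) ^+ i <= b (n + i) 1.
Proof.
move=> K0; have [Km|mK] := leqP K m; first by apply: erlang_le_tail_rec_above; lia.
have lm : 0 <= ln m%:R :> R by rewrite ln_ge0// ler1n.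
have := @tail_rec_start_level n i m 1.
rewrite m_gt0 !leqnn divr1 mul1r => /(_ isT isT).
apply: le_trans; rewrite bm divff ?gt_eqF//.
have h : m%:R * (2 / 3) ^+ i <= K%:R * (2 / 3) ^+ i :> R.
  have th : 0 <= (2 / 3 : R) ^+ i by apply: exprn_ge0; lra.
  by rewrite (ler_wpM2r th)// ler_nat ltnW.
have e1 := erlang_le1 n lm.
have : 0 <= K%:R^-1 :> R by rewrite invr_ge0.
lra.
Qed.

(** Choose i slightly above 3 ln n, so that (2/3)^i <= e^(- i / 3) <= 1 / n, and
    K slightly above sqrt n: the errors 1 / K and K / n are then
    O(1 / sqrt n), and the i skipped steps cost O(ln n / sqrt n). When
    n < 2 i the claimed bound is larger than 1. *)
Lemma tail_rec_erlang n : (3 <= n)%N ->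
  `|b n 1 - erlang_tail n (ln m%:R)|
    <= (9 + 18 * clt_const) * (ln n%:R / Num.sqrt n%:R).
Proof.
move=> n3; set s := Num.sqrt n%:R; set L := ln n%:R.
have nR : 0 < n%:R :> R by rewrite ltr0n; lia.
have s2 : s ^+ 2 = n%:R by rewrite sqr_sqrtr// ltW.
have s0 : 0 < s by rewrite sqrtr_gt0.
have c1 := @clt_const_ge1 R.
have L0 : 2 / 3 <= L := ln_ge_two_thirds n3.
have lm : 0 <= ln m%:R :> R by rewrite ln_ge0// ler1n.
have e0 := erlang_ge0 n lm; have e1 := erlang_le1 n lm.
have n0 : (0 < n)%N by lia.
have bge0 : 0 <= b n 1 by apply: tail_rec_ge0; rewrite m_gt0.
have ble1 : b n 1 <= 1 by have := @tail_rec_le_inv n 1; rewrite m_gt0 mul1r; apply.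
have up : b n 1 <= erlang_tail n (ln m%:R).
  by rewrite -(prednK n0) tail_rec_le_erlang.
rewrite ler0_norm ?subr_le0// opprB.
pose i := (Num.truncn (3 * L)).+1.
have iL : 3 * L < i%:R by rewrite truncnS_gt.
have iU : i%:R <= 9 / 2 * L.
  have : (Num.truncn (3 * L))%:R <= 3 * L by rewrite truncn_le; lra.
  by rewrite /i -natr1; lra.
have i0 : (0 < i)%N by [].
have eL : expR L = n%:R by rewrite /L lnK.
clearbody s L i.
have th : (2 / 3 : R) ^+ i <= n%:R^-1.
  rewrite -eL -expRN.
  have h : 2 / 3 <= expR (- 3^-1 : R) by have := @expR_ge1Dx R (- 3^-1); lra.
  apply: (@le_trans _ _ (expR (- 3^-1) ^+ i)).
    by rewrite lerXn2r ?nnegrE ?expR_ge0//; lra.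
  by rewrite -expRM_natr ler_expR; lra.
have Ls0 : 0 <= L / s by rewrite divr_ge0 ?(ltW s0)//; lra.
have [i2|i2] := leqP (2 * i) n; last first.
  apply: (@le_trans _ _ 1); first by lra.
  have : n%:R <= 9 * L.
    have : n%:R <= (2 * i)%:R :> R by rewrite ler_nat ltnW.
    by rewrite natrM; lra.
  rewrite -s2 => sL.
  have h : s <= 9 * (L / s).
    by rewrite mulrA ler_pdivlMr// -expr2.
  have s1 : 1 <= s by rewrite -(@ler_pXn2r _ 2) ?nnegrE ?(ltW s0)// expr1n s2 ler1n.
  have : 0 <= clt_const * (L / s) by rewrite mulr_ge0//; lra.
  lra.
pose K := (Num.truncn s).+1.
have sK : s < K%:R by rewrite truncnS_gt.
have Ks : K%:R <= s + 1.
  have : (Num.truncn s)%:R <= s by rewrite truncn_le ltW.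
  by rewrite /K -natr1 lerD2r.
have lo := erlang_le_tail_rec (n - i) i (ltn0Sn (Num.truncn s)); rewrite -/K in lo.
have K1 : 1 <= K%:R :> R by rewrite ler1n.
clearbody K.
have nE : (n - i + i)%N = n by clear -i2; lia.
have ni0 : (0 < n - i)%N by clear -i0 i2; lia.
rewrite nE in lo.
have inc := erlang_increment i ni0 lm; rewrite nE in inc.
have q : 2 * clt_const / Num.sqrt (n - i)%:R <= 4 * clt_const / s.
  have -> : 4 * clt_const / s = 2 * clt_const / (s / 2).
    by field; rewrite gt_eqF.
  have h2 : s / 2 <= Num.sqrt (n - i)%:R.
    rewrite -(@ler_pXn2r _ 2) ?nnegrE ?sqrtr_ge0 ?divr_ge0 ?(ltW s0)//.
    rewrite sqr_sqrtr// expr_div_n s2.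
    have : n%:R <= (2 * (n - i))%:R :> R by rewrite ler_nat; clear -i2; lia.
    rewrite natrM; lra.
  have h3 : 0 < s / 2 by rewrite divr_gt0.
  rewrite ler_wpM2l//; first lra.
  by rewrite lef_pV2 ?posrE// (lt_le_trans h3).
have q2 : i%:R * (2 * clt_const / Num.sqrt (n - i)%:R) <=
    9 / 2 * L * (4 * clt_const / s).
  apply: ler_pM => //.
  by rewrite divr_ge0 ?sqrtr_ge0//; lra.
have q3 : K%:R^-1 <= s^-1 by rewrite lef_pV2 ?posrE ?ltW// (lt_trans s0).
have s1 : 1 <= s by rewrite -(@ler_pXn2r _ 2) ?nnegrE ?(ltW s0)// expr1n s2 ler1n.
have q4 : K%:R * (2 / 3) ^+ i <= 2 * s^-1.
  apply: (@le_trans _ _ (K%:R * n%:R^-1)); first by rewrite ler_wpM2l.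
  rewrite -s2; have -> : 2 * s^-1 = (2 * s) / s ^+ 2 by field; rewrite gt_eqF.
  by rewrite ler_wpM2r ?invr_ge0 ?sqr_ge0//; lra.
have q5 : s^-1 <= 3 / 2 * (L / s).
  by rewrite mulrA -[leLHS]mul1r ler_wpM2r ?invr_ge0 ?(ltW s0)//; lra.
have -> : (9 + 18 * clt_const) * (L / s) =
    9 * (L / s) + 9 / 2 * L * (4 * clt_const / s).
  by field; rewrite gt_eqF.
lra.
Qed.

End Recursion.

(** * Engel digits as orbits of a map *)

Section EngelDigits.
Context {R : realType}.
Implicit Types (x : R) (q : nat -> nat) (n j m : nat).

(** For 0 < x <= 1, the integer j.+1 with 1 / j.+1 < x <= 1 / j. The intervals
    are closed on the right because expansions are infinite: a rational x has
    a constant tail of digits and no zero remainder. *)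
Definition engel_head x : nat := (Num.truncn x^-1).+1.

Definition engel_map x : R := (engel_head x)%:R * x - 1.

Lemma engel_headE x j : (0 < j)%N -> 0 < x -> (engel_head x = j.+1) <->
  (j.+1%:R^-1 < x <= j%:R^-1).
Proof.
move=> j0 x0; have jR : 0 < j%:R :> R by rewrite ltr0n.
have xi0 : 0 <= x^-1 by rewrite invr_ge0 ltW.
have -> : (j.+1%:R^-1 < x <= j%:R^-1) = (j%:R <= x^-1 < j.+1%:R).
  by rewrite andbC -[in LHS](invrK x) lef_pV2 ?ltf_pV2 ?posrE ?invr_gt0.
rewrite -truncn_eq// /engel_head; split; first by move=> [->].
by move/eqP ->.
Qed.

Lemma engel_head_ge x j : (0 < j)%N -> 0 < x ->
  (j < engel_head x)%N = (x <= j%:R^-1).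
Proof.
move=> j0 x0; have jR : 0 < j%:R :> R by rewrite ltr0n.
rewrite /engel_head ltnS truncn_ge_nat ?invr_ge0 ?(ltW x0)//.
by rewrite -[in RHS](invrK x) lef_pV2 ?posrE ?invr_gt0.
Qed.

Lemma inv_succ j : (0 < j)%N ->
  j%:R^-1 = j.+1%:R^-1 * (1 + j%:R^-1) :> R.
Proof.
move=> j0; rewrite -natr1; field.
by rewrite natr1 !pnatr_eq0 -lt0n j0.
Qed.

(** Invariance of (0, 1/j] is the monotonicity of the digits. *)
Lemma engel_map_stable x j : (0 < j)%N -> 0 < x <= j%:R^-1 ->
  0 < engel_map x <= j%:R^-1.
Proof.
move=> j0 /andP[x0 xj]; have jR : 0 < j%:R :> R by rewrite ltr0n.
pose i := (engel_head x).-1.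
have ij : (j <= i)%N by rewrite -ltnS -engel_head_ge// in xj *.
have i0 : (0 < i)%N by apply: leq_trans ij.
have hi : engel_head x = i.+1 by [].
have /andP[h1 h2] := (engel_headE i0 x0).1 hi.
have iR : 0 < i%:R :> R by rewrite ltr0n.
rewrite /engel_map hi; apply/andP; split.
  by rewrite subr_gt0 -ltr_pdivrMl// mulr1.
apply: (@le_trans _ _ i%:R^-1); last by rewrite lef_pV2 ?posrE// ler_nat.
rewrite lerBlDr -ler_pdivlMl//; apply: (le_trans h2).
by rewrite addrC -inv_succ.
Qed.

Lemma iter_engel_map_stable n x j : (0 < j)%N -> 0 < x <= j%:R^-1 ->
  0 < iter n engel_map x <= j%:R^-1.
Proof. by move=> j0 xj; elim: n => //= n IH; exact: engel_map_stable. Qed.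

Definition engel_term q n : R := (\prod_(i < n.+1) (q i)%:R)^-1.

Lemma engel_series_step q n :
  series (engel_term q) n.+1 =
  (q 0)%:R^-1 * (1 + series (engel_term (fun i => q i.+1)) n).
Proof.
rewrite /series /= big_nat_recl//= mulrDr mulr1; congr (_ + _).
  by rewrite /engel_term big_ord1.
rewrite mulr_sumr; apply: eq_bigr => i _.
by rewrite /engel_term big_ord_recl/= invfM.
Qed.

(** The largest value for a given first digit is the geometric series with
    all digits equal to it. *)
Lemma engel_series_le q n : (forall i, (2 <= q i <= q i.+1)%N) ->
  series (engel_term q) n <= ((q 0).-1)%:R^-1.
Proof.
elim: n q => [|n IH] q qm; first by rewrite /series /= big_geq// invr_ge0.
have /andP[q2 q01] := qm 0; have /andP[q12 _] := qm 1.
rewrite engel_series_step.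
have -> : ((q 0).-1)%:R^-1 = (q 0)%:R^-1 * (1 + ((q 0).-1)%:R^-1) :> R.
  by rewrite -[in (q 0)%:R](prednK (ltnW q2)) -inv_succ// -ltnS prednK// ltnW.
rewrite ler_wpM2l ?invr_ge0// lerD2l.
apply: le_trans (IH _ (fun i => qm i.+1)) _.
rewrite lef_pV2 ?posrE ?ltr0n ?ler_nat; lia.
Qed.

Lemma engel_expansion_itv x q : engel_expansion x q ->
  0 < x <= ((q 0).-1)%:R^-1.
Proof.
move=> [qm cq]; have qi0 i : 0 < (q i)%:R :> R.
  by rewrite ltr0n; have := qm i; lia.
have t0 n : 0 < engel_term q n by rewrite invr_gt0 prodr_gt0.
apply/andP; split.
  apply: (@lt_le_trans _ _ (engel_term q 0)) => //.
  apply: (ler_cvg_to (cvg_cst (engel_term q 0)) cq); near=> n.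
  have n0 : (0 < n)%N by near: n; exact: nbhs_infty_gt.
  rewrite /series /= -(prednK n0) big_nat_recl//= lerDl sumr_ge0// => i _.
  exact: (ltW (t0 i.+1)).
apply: (ler_cvg_to cq (cvg_cst _)); near=> n.
exact: engel_series_le.
Unshelve. all: by end_near. Qed.

(** The rest of the expansion is an expansion of q_0 x - 1, which is therefore
    positive; together with the upper bound 1 / (q_0 - 1) on x this pins down
    q_0, and hence uniqueness. *)
Lemma engel_expansion_step x q : engel_expansion x q ->
  engel_head x = q 0 /\ engel_expansion (engel_map x) (fun i => q i.+1).
Proof.
move=> exq; have [qm cq] := exq; have /andP[x0 xq] := engel_expansion_itv exq.
have /andP[q2 _] := qm 0; have q0 : 0 < (q 0)%:R :> R by rewrite ltr0n; lia.
have ex' : engel_expansion ((q 0)%:R * x - 1) (fun i => q i.+1).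
  split; first by move=> n; exact: qm.
  rewrite (_ : series _ =
    fun n => (q 0)%:R * series (engel_term q) n.+1 - 1); last first.
    apply/funext => n; rewrite engel_series_step mulrA divff ?gt_eqF//.
    by rewrite mul1r addrC addKr.
  apply: cvgB; last exact: cvg_cst.
  apply: cvgM; first exact: cvg_cst.
  by rewrite (cvg_shiftS (series (engel_term q))).
have /andP[x0' _] := engel_expansion_itv ex'.
have hq : engel_head x = q 0.
  rewrite -(prednK (ltnW q2)); apply/engel_headE => //; first lia.
  rewrite xq andbT prednK ?(ltnW q2)// -[_^-1]mulr1 ltr_pdivrMl//; lra.
by rewrite /engel_map hq.
Qed.

Lemma engel_expansion_unique x q n : engel_expansion x q ->
  q n = engel_head (iter n engel_map x).
Proof.
elim: n x q => [|n IH] x q /engel_expansion_step[hq hS] //.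
by rewrite iterSr (IH (engel_map x) (fun i => q i.+1)).
Qed.

Lemma engel_remainder x n : 0 < x <= 1 ->
  x = series (engel_term (fun i => engel_head (iter i engel_map x))) n
    + (\prod_(i < n) (engel_head (iter i engel_map x))%:R)^-1
      * iter n engel_map x.
Proof.
move=> x01; elim: n => [|n IH].
  by rewrite /series /= big_geq// big_ord0 invr1 mul1r add0r.
rewrite {1}IH /series /= big_nat_recr//= -addrA; congr (_ + _).
rewrite /engel_term big_ord_recr /=.
set p := \prod_(i < n) _; set y := iter n engel_map x.
have h0 : (engel_head y)%:R != 0 :> R by rewrite pnatr_eq0.
have p0 : p != 0.
  by rewrite prodf_seq_neq0; apply/allP => i _ /=; rewrite pnatr_eq0.
by rewrite /engel_map; field; rewrite h0 p0.
Qed.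

(** The remainder after n digits is positive and at most 2^-n, all digits being
    at least 2. *)
Lemma engel_expansion_exists x : 0 < x <= 1 ->
  engel_expansion x (fun i => engel_head (iter i engel_map x)).
Proof.
move=> x01; have x01' : 0 < x <= 1%:R^-1 by rewrite invr1.
have st n := iter_engel_map_stable n (ltn0Sn 0) x01'.
split.
  move=> n; have /andP[y0 y1] := st n.
  rewrite (engel_head_ge (ltn0Sn 0) y0) y1 /=.
  set y := iter n engel_map x in y0 y1 *.
  pose i := (engel_head y).-1; have hi : engel_head y = i.+1 by [].
  have i0 : (0 < i)%N by rewrite /i -ltnS prednK// (engel_head_ge (ltn0Sn 0) y0).
  have /andP[_ h2] := (engel_headE i0 y0).1 hi.
  have yi : 0 < y <= i%:R^-1 by rewrite y0.
  have /andP[z0 z1] := engel_map_stable i0 yi.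
  by rewrite hi (engel_head_ge i0 z0).
pose q i := engel_head (iter i engel_map x).
rewrite (_ : series _ =
    fun n => x - (\prod_(i < n) (q i)%:R)^-1 * iter n engel_map x); last first.
  by apply/funext => n; rewrite {2}(engel_remainder n x01) addrK.
rewrite -[X in _ --> X]subr0; apply: cvgB; first exact: cvg_cst.
have c : (2^-1 : R) ^+ n @[n --> \oo] --> (0 : R).
  by apply: cvg_expr; rewrite ger0_norm//; lra.
apply: (squeeze_cvgr _ (cvg_cst 0) c); near=> n.
have /andP[y0 y1] := st n; rewrite invr1 in y1.
have p0 : 0 < \prod_(i < n) (q i)%:R :> R.
  by apply: prodr_gt0 => i _; rewrite ltr0n.
apply/andP; split; first by rewrite mulr_ge0// ?invr_ge0 ltW.
apply: (@le_trans _ _ (\prod_(i < n) (q i)%:R)^-1).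
  by rewrite ler_piMr// invr_ge0 ltW.
rewrite exprVn lef_pV2 ?posrE// -[n in _ ^+ n]card_ord -prodr_const.
apply: ler_prod => i _; rewrite ler0n /= ler_nat /q.
by have /andP[z0 z1] := st i; rewrite (engel_head_ge (ltn0Sn 0) z0).
Unshelve. all: by end_near. Qed.

Lemma engel_digits_in x n : 0 < x <= 1 ->
  engel_digits x n = engel_head (iter n engel_map x).
Proof.
move=> x01; apply: engel_expansion_unique; rewrite /engel_digits.
exact: (xgetPex _ (ex_intro _ _ (engel_expansion_exists x01))).
Qed.

Lemma engel_digits_out x n : ~~ (0 < x <= 1) -> engel_digits x n = 2.
Proof.
move=> x01; rewrite /engel_digits xgetPN// => q exq.
move/negP : x01; apply; have /andP[-> xq] := engel_expansion_itv exq.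
apply: (le_trans xq); rewrite invf_le1 ?ler1n ?ltr0n; have [/(_ 0)] := exq; lia.
Qed.

End EngelDigits.

(** * Finite unions of intervals *)

Section IntervalUnions.
Context {R : realType}.
Implicit Types (A B : set R) (a b c l : R).

(** Sets built this way are measurable with a known length, and the class is
    stable under disjoint unions and affine preimages by plain induction. *)
Inductive itv_union : set R -> R -> Prop :=
| itv_union0 : itv_union set0 0
| itv_unionU a b A l : a <= b -> `]a, b]%classic `&` A = set0 ->
    itv_union A l -> itv_union (`]a, b]%classic `|` A) (b - a + l).

Lemma itv_union_measure A l : itv_union A l ->
  measurable A /\ lebesgue_measure A = l%:E.
Proof.
elim=> [|a b {}A {}l ab dis _ [mA lA]]; first by rewrite measure0.
split; first exact: measurableU.
have lab : lebesgue_measure `]a, b]%classic = (b - a)%:E.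
  rewrite lebesgue_measure_itv/= lte_fin; case: ltP => // ba.
  by congr EFin; apply/esym/eqP; rewrite subr_eq0 eq_le ab ba.
by rewrite measureU// [X in (_ + X)%E]lA [X in (X + _)%E]lab EFinD.
Qed.

Lemma itv_union_itv a b : a <= b -> itv_union `]a, b]%classic (b - a).
Proof.
move=> ab; rewrite -[b - a]addr0 -[X in itv_union X]setU0.
by apply: itv_unionU => //; [rewrite setI0|exact: itv_union0].
Qed.

Lemma itv_union_setU A B l l' : itv_union A l -> itv_union B l' ->
  A `&` B = set0 -> itv_union (A `|` B) (l + l').
Proof.
elim=> [|a b {}A {}l ab dis _ IH] hB; first by rewrite set0U add0r.
rewrite setIUl setU_eq0 => -[d1 d2].
rewrite -setUA -addrA; apply: itv_unionU => //; last exact: IH.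
by rewrite setIUr dis d1 setU0.
Qed.

Lemma itv_union_preimage A l c : 0 < c -> itv_union A l ->
  itv_union [set x | A (c * x - 1)] (l / c).
Proof.
move=> c0; elim=> [|a b {}A {}l ab dis _ IH].
  by rewrite mul0r; exact: itv_union0.
have -> : [set x | (`]a, b]%classic `|` A) (c * x - 1)] =
    `](a + 1) / c, (b + 1) / c]%classic `|` [set x | A (c * x - 1)].
  apply/seteqP; split=> x /= [h|h]; [left|right|left|right] => //; move: h;
    rewrite !in_itv/= => /andP[h1 h2]; apply/andP; split.
  - by rewrite ltr_pdivrMr// mulrC; lra.
  - by rewrite ler_pdivlMr// mulrC; lra.
  - by move: h1; rewrite ltr_pdivrMr// mulrC; lra.
  - by move: h2; rewrite ler_pdivlMr// mulrC; lra.
have -> : (b - a + l) / c = (b + 1) / c - (a + 1) / c + l / c.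
  by field; rewrite gt_eqF.
apply: itv_unionU => //.
  by rewrite ler_pM2r ?invr_gt0// lerD2r.
apply/seteqP; split=> // x /= [+ h]; rewrite in_itv/= => /andP[h1 h2].
have : (`]a, b]%classic `&` A) (c * x - 1).
  split=> //=; rewrite in_itv/=; apply/andP; split.
  - by move: h1; rewrite ltr_pdivrMr// mulrC; lra.
  - by move: h2; rewrite ler_pdivlMr// mulrC; lra.
by rewrite dis.
Qed.

End IntervalUnions.

(** * The law of a digit *)

Section TailSets.
Context {R : realType}.
Implicit Types (x : R) (n j m : nat).

(** The x in (0, 1/j] whose n-th digit exceeds m. For n = 0 the role of the
    digit is played by j + 1, which makes the decomposition by the first digit
    uniform in n. *)
Definition tail_set m n j : set R :=
  match n with
  | 0 => [set x | 0 < x <= j%:R^-1 /\ (m <= j)%N]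
  | n'.+1 => [set x | 0 < x <= j%:R^-1 /\
               (m < engel_head (iter n' engel_map x))%N]
  end.

Lemma tail_set_top m n : (0 < m)%N -> tail_set m n m = `]0, m%:R^-1]%classic.
Proof.
move=> m0; apply/seteqP; split=> x; case: n => [|n] /=; rewrite in_itv/=.
- by case.
- by case.
- by [].
- move=> xm; split=> //; have /andP[y0 ym] := iter_engel_map_stable n m0 xm.
  by rewrite (engel_head_ge m0 y0).
Qed.

(** On (1/(j+1), 1/j] the first digit is j + 1 and the orbit continues from
    (j+1) x - 1, which ranges over (0, 1/j]. *)
Lemma tail_set_step m n j : (0 < j < m)%N ->
  tail_set m n.+1 j =
  [set x | tail_set m n j (j.+1%:R * x - 1)] `|` tail_set m n.+1 j.+1.
Proof.
move=> /andP[j0 jm]; have jR : 0 < j%:R :> R by rewrite ltr0n.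
have jj : j.+1%:R^-1 <= j%:R^-1 :> R by rewrite lef_pV2 ?posrE// ler_nat.
have low x : 0 < j.+1%:R * x - 1 <-> j.+1%:R^-1 < x.
  by rewrite subr_gt0 -ltr_pdivrMl// mulr1.
have upp x : j.+1%:R * x - 1 <= j%:R^-1 <-> x <= j%:R^-1.
  by rewrite lerBlDr addrC -ler_pdivlMl// -inv_succ.
have hd x : j.+1%:R^-1 < x -> x <= j%:R^-1 ->
    engel_head x = j.+1 /\ engel_map x = j.+1%:R * x - 1.
  move=> x1 x2; have x0 : 0 < x by apply: lt_trans x1; rewrite invr_gt0.
  have h : engel_head x = j.+1 by apply/engel_headE; rewrite ?x1.
  by rewrite /engel_map h.
have mid x n' : j.+1%:R^-1 < x -> x <= j%:R^-1 ->
    (m < engel_head (iter n' engel_map x))%N <->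
    tail_set m n' j (j.+1%:R * x - 1).
  move=> x1 x2; have [h1 h2] := hd x x1 x2.
  have r : 0 < j.+1%:R * x - 1 <= j%:R^-1.
    by apply/andP; split; [apply/low|apply/upp].
  case: n' => [|n'] /=.
    rewrite h1 ltnS; split; first by [].
    by case.
  by rewrite -iterS iterSr h2; split=> [|[]].
apply/seteqP; split=> x /=.
  move=> [/andP[x0 x2] xm]; have [x1|x1] := leP x j.+1%:R^-1.
    by right; rewrite x0.
  by left; apply/(mid x n x1 x2).
move=> [h|[/andP[x0 x1] xm]]; last first.
  by split=> //; rewrite x0 (le_trans x1).
have /andP[/low x1 /upp x2] : 0 < j.+1%:R * x - 1 <= j%:R^-1.
  by case: n h {mid} => [|n] [].
split; last exact/(mid x n x1 x2).
by rewrite x2 andbT (lt_trans _ x1)// invr_gt0.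
Qed.

Lemma tail_set_disjoint m n n' j :
  [set x | tail_set m n j (j.+1%:R * x - 1)] `&` tail_set m n' j.+1 = set0.
Proof.
apply/seteqP; split=> // x /= [h1 h2].
have : 0 < j.+1%:R * x - 1 by case: n h1 => [|n] [/andP[]].
have : x <= j.+1%:R^-1 by case: n' h2 => [|n'] [/andP[]].
by rewrite subr_gt0 -ltr_pdivrMl// mulr1 ltNge => ->.
Qed.

Lemma tail_set_itv_union m n j : (0 < j <= m)%N ->
  exists l, itv_union (tail_set m n j) l.
Proof.
case: m => [|m]; first by case: j.
have top k : exists l, itv_union (tail_set m.+1 k m.+1) l.
  by rewrite tail_set_top//; eexists; apply: itv_union_itv; rewrite invr_ge0.
elim: n j => [|n IH] j.
  move=> /andP[j0]; rewrite leq_eqVlt => /predU1P[->|jm]; first exact: top.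
  exists 0; rewrite (_ : tail_set _ _ _ = set0); first exact: itv_union0.
  by apply/seteqP; split=> // x /= [_]; rewrite leqNgt jm.
move: j; apply: downward_ind; first exact: top.
move=> j jm [l hl]; have [l' hl'] : exists l, itv_union (tail_set m.+1 n j) l.
  by apply: IH; lia.
exists (l' / j.+1%:R + l); rewrite tail_set_step//; apply: itv_union_setU => //.
  exact: itv_union_preimage.
exact: tail_set_disjoint.
Qed.

Definition tail_measure m n j : R := fine (lebesgue_measure (tail_set m n j)).

Lemma tail_measureE m n j l : itv_union (tail_set m n j) l ->
  tail_measure m n j = l.
Proof. by move=> /itv_union_measure[_]; rewrite /tail_measure => ->. Qed.

Lemma tail_measure0 m j : (0 < j < m)%N -> tail_measure m 0 j = 0.
Proof.
move=> /andP[j0 jm]; apply: tail_measureE.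
rewrite (_ : tail_set _ _ _ = set0); first exact: itv_union0.
by apply/seteqP; split=> // x /= [_]; rewrite leqNgt jm.
Qed.

Lemma tail_measure_top m n : (0 < m)%N -> tail_measure m n m = m%:R^-1.
Proof.
move=> m0; apply: tail_measureE.
rewrite tail_set_top// -[X in itv_union _ X]subr0.
by apply: itv_union_itv; rewrite invr_ge0.
Qed.

Lemma tail_measureS m n j : (0 < j < m)%N ->
  tail_measure m n.+1 j = tail_measure m n.+1 j.+1 + tail_measure m n j / j.+1%:R.
Proof.
move=> jm.
have [l hl] : exists l, itv_union (tail_set m n.+1 j.+1) l.
  by apply: tail_set_itv_union; lia.
have [l' hl'] : exists l, itv_union (tail_set m n j) l.
  by apply: tail_set_itv_union; lia.
rewrite (tail_measureE hl) (tail_measureE hl') addrC; apply: tail_measureE.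
rewrite tail_set_step//; apply: itv_union_setU => //.
  exact: itv_union_preimage.
exact: tail_set_disjoint.
Qed.

Lemma tail_measure_erlang m n : (0 < m)%N -> (3 <= n)%N ->
  `|tail_measure m n 1 - erlang_tail n (ln m%:R)|
    <= (9 + 18 * clt_const) * (ln n%:R / Num.sqrt n%:R).
Proof.
move=> m0 n3; apply: tail_rec_erlang => //.
- by move=> j jm; apply: tail_measure0.
- by move=> k; apply: tail_measure_top.
- by move=> k j jm; apply: tail_measureS.
Qed.

Lemma uniform_prob_lebesgue (A : set R) :
  measurable A -> A `<=` `[0, 1]%classic ->
  uniform_prob (@ltr01 R) A = lebesgue_measure A.
Proof.
move=> mA A01; rewrite /uniform_prob (eq_integral (cst 1%:E)).
  by rewrite integral_cst// mul1e.
move=> x /set_mem /A01 /=; rewrite in_itv/= /uniform_pdf => ->.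
by rewrite subr0 invr1.
Qed.

(** Outside (0, 1] all digits are 2 by convention, so for m >= 2 the event lies
    in (0, 1], where the law is Lebesgue measure; for m = 1 it is
    certain. *)
Lemma engel_digit_tail_prob d (T : measurableType d) (P : probability T R)
    (X : {RV P >-> R}) m n : uniform01 X -> (0 < m)%N -> (0 < n)%N ->
  measurable [set w | (m < engel_digit n (X w))%N] /\
  P [set w | (m < engel_digit n (X w))%N] = (tail_measure m n 1)%:E.
Proof.
move=> unif m0 n0.
have [m1|m1] := leqP m 1.
  have -> : m = 1 by lia.
  have -> : [set w | (1 < engel_digit n (X w))%N] = setT.
    apply/seteqP; split=> // w _ /=; rewrite /engel_digit.
    have [x01|x01] := boolP (0 < X w <= 1); last by rewrite engel_digits_out.
    rewrite engel_digits_in//; rewrite -[X in _ <= X]invr1 in x01.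
    have /andP[y0 y1] := iter_engel_map_stable n.-1 (ltn0Sn 0) x01.
    by rewrite (engel_head_ge (ltn0Sn 0) y0).
  by rewrite probability_setT tail_measure_top// invr1.
have AE : [set w | (m < engel_digit n (X w))%N] = X @^-1` tail_set m n 1.
  apply/seteqP; split=> w;
    rewrite -[in tail_set _ _](prednK n0) /= /engel_digit invr1.
    have [x01|x01] := boolP (0 < X w <= 1); last first.
      by rewrite engel_digits_out// ltnNge m1.
    by rewrite engel_digits_in.
  by move=> [x01]; rewrite engel_digits_in.
have [l hl] : exists l, itv_union (tail_set m n 1) l.
  by apply: tail_set_itv_union; lia.
have [mA lA] := itv_union_measure hl.
rewrite AE; split; first exact: measurable_funPTI.
rewrite (tail_measureE hl) -lA -uniform_prob_lebesgue//; first by rewrite -unif.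
move=> x; rewrite /= in_itv/= -(prednK n0) /= invr1 => -[/andP[x0 ->] _].
by rewrite ltW.
Qed.

End TailSets.

(** * The rate of convergence *)

Section KolmogorovBound.
Context {R : realType}.

Lemma engel_digit_gt0 n (x : R) : (0 < engel_digit n x)%N.
Proof.
rewrite /engel_digit; have [x01|x01] := boolP (0 < x <= 1).
  by rewrite engel_digits_in.
by rewrite engel_digits_out.
Qed.

(** Digits are integers, so the threshold e^(n + x sqrt n) may be rounded
    down. *)
Lemma normalized_log_digit_le n (u x : R) : (0 < n)%N ->
  (normalized_log_digit n u <= x) =
  (engel_digit n u <= Num.truncn (expR (n%:R + x * Num.sqrt n%:R)))%N.
Proof.
move=> n0; rewrite /normalized_log_digit ler_pdivrMr ?sqrtr_gt0 ?ltr0n//.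
rewrite truncn_ge_nat ?expR_ge0// lerBlDl.
by rewrite -ler_expR lnK// posrE ltr0n engel_digit_gt0.
Qed.

Definition rate_const : R := 21 + 39 * clt_const.

(** Let t = n + x sqrt n and m the integer part of e^t. The probability of
    q_n > m is the Erlang tail of order n at ln m; moving from ln m to t and
    from order n to n + 1 costs O(1 / sqrt n) each, and the Erlang tail
    of order n + 1 at t is 1 - Phi x up to O(1 / sqrt n). If m = 0 then
    x < - sqrt n, where Phi itself is at most 1 / sqrt n. *)
Lemma kolmogorov_bound d (T : measurableType d) (P : probability T R)
    (X : {RV P >-> R}) n (x : R) : uniform01 X -> (3 <= n)%N ->
  exists2 p : R, P [set w | normalized_log_digit n (X w) <= x] = p%:E &
    `|p - Phi x| <= rate_const * (ln n%:R / Num.sqrt n%:R).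
Proof.
move=> unif n3; have n0 : (0 < n)%N by lia.
have c1 := @clt_const_ge1 R; have L0 := @ln_ge_two_thirds R _ n3.
set s := Num.sqrt n%:R; set L := ln n%:R in L0 *.
have nR : 0 < n%:R :> R by rewrite ltr0n.
have s2 : s ^+ 2 = n%:R by rewrite sqr_sqrtr// ltW.
have s0 : 0 < s by rewrite sqrtr_gt0.
have is0 : 0 < s^-1 by rewrite invr_gt0.
have Ls : s^-1 <= 3 / 2 * (L / s).
  by rewrite mulrA -[leLHS]mul1r ler_wpM2r ?(ltW is0)//; lra.
pose t := n%:R + x * s; pose m := Num.truncn (expR t).
have setE : [set w | normalized_log_digit n (X w) <= x] =
    [set w | (engel_digit n (X w) <= m)%N].
  by apply/seteqP; split=> w /=; rewrite normalized_log_digit_le.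
have cLs : 0 <= clt_const * (L / s).
  by rewrite mulr_ge0 ?divr_ge0 ?(ltW s0)//; lra.
have [m0|m0] := posnP m.
  exists 0.
    rewrite setE m0 (_ : [set _ | _] = set0) ?measure0//.
    by apply/seteqP; split=> // w /=; rewrite leqNgt engel_digit_gt0.
  have xs : x <= - s.
    have : expR t < 1 by rewrite -[1]/(0.+1%:R) -truncn_le_nat -/m m0.
    rewrite expR_lt1 /t -s2 => h; rewrite -(ler_pM2r s0) mulNr -expr2; lra.
  have := Phi_ge0 x; have := Phi_homo xs; have := Phi_lower_tail s0.
  rewrite sub0r normrN => ? ? ?; rewrite ger0_norm// /rate_const; lra.
have t0 : 0 <= t.
  by rewrite -ler_expR expR0 -truncn_gt0.
have [mA PA] := engel_digit_tail_prob unif m0 n0.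
exists (1 - tail_measure m n 1).
  rewrite setE EFinB -PA -probability_setC//; congr (P _).
  apply/seteqP; split=> w /= => [|/negP]; last by rewrite -leqNgt.
  by rewrite leqNgt => /negP.
have mR : 0 < m%:R :> R by rewrite ltr0n.
have mle : ln m%:R <= t.
  by rewrite -ler_expR lnK ?posrE// truncn_le expR_ge0.
have mge : t - ln m%:R <= 1.
  rewrite lerBlDr -ler_expR [expR (1 + _)]expRD lnK ?posrE//.
  have h1 : expR t < m.+1%:R by exact: truncnS_gt.
  have h2 : m.+1%:R <= 2 * m%:R :> R.
    by rewrite -natrM ler_nat; clear -m0; lia.
  have h3 : 2 * m%:R <= expR 1 * m%:R :> R.
    by rewrite ler_pM2r//; have := @expR_ge1Dx R 1; lra.
  by rewrite (le_trans (ltW h1))// (le_trans h2).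
have lm : 0 <= ln m%:R :> R by rewrite ln_ge0// ler1n.
have xs : - s <= x.
  by move: t0; rewrite /t -s2 expr2 -mulrDl pmulr_lge0// -lerBlDl sub0r.
have a1 := @tail_measure_erlang R m n m0 n3.
have a2 := erlang_cdf_normal n0 s0 s2 xs.
have a3 := le_trans (pois_peak n0 t0) (pois_peak_le n0 s0 s2).
have a3' := pois_ge0 n t0.
have a4 : `|erlang_tail n (ln m%:R) - erlang_tail n t| <= 4 * clt_const / s.
  have n1 : (0 < n.-1)%N by clear -n3; lia.
  have h := erlang_lipschitz n1 lm mle; rewrite (prednK n0) in h.
  rewrite ger0_norm ?subr_ge0 ?erlang_nonincreasing//; apply: (le_trans h).
  have s1 : s / 2 <= Num.sqrt n.-1%:R.
    rewrite -(@ler_pXn2r _ 2) ?nnegrE ?sqrtr_ge0 ?divr_ge0 ?(ltW s0)//.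
    rewrite sqr_sqrtr// expr_div_n s2.
    have : n%:R <= (2 * n.-1)%:R :> R by rewrite ler_nat; clear -n3; lia.
    by rewrite natrM; lra.
  have s20 : 0 < s / 2 by rewrite divr_gt0.
  apply: (@le_trans _ _ (1 * (2 * clt_const / (s / 2)))).
    apply: ler_pM => //; first by rewrite subr_ge0.
      by rewrite divr_ge0 ?sqrtr_ge0//; lra.
    rewrite ler_wpM2l//; first by lra.
    by rewrite lef_pV2 ?posrE// (lt_le_trans s20).
  have -> // : 1 * (2 * clt_const / (s / 2)) = 4 * clt_const / s.
  by field; rewrite gt_eqF.
have eS := erlangS n t.
have cdfE : erlang_cdf n s x = 1 - erlang_tail n.+1 t by [].
have c_s : clt_const / s <= 3 / 2 * (clt_const * (L / s)).
  have h := ler_wpM2l (le_trans ler01 c1) Ls; apply: (le_trans h).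
  by rewrite mulrCA.
rewrite cdfE in a2; rewrite -/L -/s in a1.
move: a1 a2 a3 a3' a4 eS c_s Ls cLs is0; rewrite /rate_const.
move: (tail_measure m n 1) (erlang_tail n (ln m%:R)) (erlang_tail n t)
  (erlang_tail n.+1 t)
  (pois n t) (Phi x) (clt_const : R) (L / s) (s^-1).
clear => a g1 g2 g3 p F c l v.
rewrite !ler_norml => /andP[? ?] /andP[? ?] ? ? /andP[? ?] ? ? ? ? ?.
by apply/andP; split; lra.
Qed.

(** With r = n^(1/4), ln n = 4 ln r <= 4 r while sqrt n = r^2. *)
Lemma ln_sqrt_small (e : R) : 0 < e ->
  \forall n \near \oo, ln n%:R / Num.sqrt n%:R <= e.
Proof.
move=> e0; near=> n.
have n0 : (0 < n)%N by near: n; exact: nbhs_infty_gt.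
have ne : (4 / e) ^+ 4 <= n%:R by near: n; exact: nbhs_infty_ger.
set s := Num.sqrt n%:R; pose r := Num.sqrt s.
have s0 : 0 < s by rewrite sqrtr_gt0 ltr0n.
have r0 : 0 < r by rewrite sqrtr_gt0.
have rs : r ^+ 2 = s by rewrite sqr_sqrtr// ltW.
have nr : n%:R = r ^+ 4 by rewrite (exprM r 2 2) rs sqr_sqrtr.
have re : 4 / e <= r.
  by rewrite -(@ler_pXn2r _ 4) ?nnegrE ?divr_ge0 ?(ltW e0) ?(ltW r0)// -nr.
rewrite {1}nr lnXn// -mulr_natl -rs ler_pdivrMr ?exprn_gt0//.
have lr : ln r <= r by rewrite ltW// ln_sublinear.
apply: (@le_trans _ _ (4 * r)); first by rewrite ler_wpM2l.
by rewrite expr2 mulrA ler_pM2r// mulrC -ler_pdivrMr.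
Unshelve. all: by end_near. Qed.

End KolmogorovBound.

Theorem corollary2p5 (R : realType) :
  (exists C : R, 0 < C /\
    forall (d : measure_display) (T : measurableType d) (P : probability T R)
           (X : {RV P >-> R}), uniform01 X ->
    forall n : nat, (3 <= n)%N ->
      (ereal_sup [set `| P [set w | (normalized_log_digit n (X w) <= x)%R]
                         - std_normal_cdf x | | x in [set: R]]
       <= (C * (ln n%:R / Num.sqrt n%:R))%:E)%E)
  /\
  (forall (d : measure_display) (T : measurableType d) (P : probability T R)
          (X : {RV P >-> R}), uniform01 X ->
    cvg_in_distribution P (fun n w => normalized_log_digit n (X w))
      (normal_prob (0 : R) 1)).
Proof.
have C0 : 0 < @rate_const R.
  by rewrite /rate_const; have := @clt_const_ge1 R; lra.
split.
  exists rate_const; split=> // d T P X unif n n3.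
  apply: ge_ereal_sup => _ [x _ <-].
  have [p -> pP] := kolmogorov_bound x unif n3.
  by rewrite /std_normal_cdf normal_prob_Phi -EFinB /= lee_fin.
move=> d T P X unif x _.
have bound n : (3 <= n)%N ->
    `|fine (P [set w | normalized_log_digit n (X w) <= x]) - Phi x|
      <= rate_const * (ln n%:R / Num.sqrt n%:R).
  by move=> n3; have [p -> pP] := kolmogorov_bound x unif n3.
rewrite [X in _ --> X](_ : _ = (Phi x)%:E); last exact: normal_prob_Phi.
apply/fine_cvgP; split.
  near=> n; have n3 : (3 <= n)%N by near: n; exact: nbhs_infty_ge.
  by have [p ->] := kolmogorov_bound x unif n3.
apply/cvgrPdist_le => e e0; near=> n.
have n3 : (3 <= n)%N by near: n; exact: nbhs_infty_ge.
rewrite distrC /=; apply: le_trans (bound n n3) _.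
rewrite -ler_pdivlMl//; near: n; apply: ln_sqrt_small.
by rewrite mulr_gt0// invr_gt0.
Unshelve. all: by end_near. Qed.
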